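(* Fix $p,q$ such that either $p=q\in[2,\infty)$, or $q=2$ and $p\in(1,\infty)$. Let $X,Y\in\mathcal{D}_p[l^q]$ be diagrams having finitely many points outside the diagonal, and let $\mu:[0,1]\to\mathcal{D}_p[l^q]$ be a geodesic from $X$ to $Y$. Then there exists a convex-combination geodesic $\gamma:[0,1]\to\mathcal{D}_p[l^q]$ from $X$ to $Y$ such that for each $t\in[0,1]$ we have $d_p[l^q](\gamma(t),\mu(t))=0$.
   Context: Let $\Delta=\{(x,x):x\in\mathbb{R}\}\subset\mathbb{R}^2$ and $\mathbb{R}^2_>=\{(a,b)\in\mathbb{R}^2: b>a\}$. A persistence diagram is a countable subset of $\mathbb{R}^2_>\times\mathbb{N}$ together with countably infinitely many copies of $\Delta$ (i.e. every point of $\Delta$ is counted with countably infinite multiplicity). The $\mathbb{R}^2$-component of a point is its geometric component; the $\mathbb{N}$-component is an index that only serves to distinguish different copies of the same geometric point, so that a diagram encodes a multiset in $\mathbb{R}^2$. The set of all persistence diagrams is $\mathcal{D}$. The empty diagram $\varnothing$ consists only of the diagonal with countably infinite multiplicity. For points $x,y$ of diagrams, $\|x-y\|_q$ denotes the $q$-norm in $\mathbb{R}^2$ of the difference of their geometric components (the index is ignored). For $p\in[1,\infty)$, $q\in[1,\infty]$, $X,Y\in\mathcal{D}$ and a bijection $\varphi:X\to Y$ (all diagonal copies included), put $C_p[l^q](\varphi)=\left(\sum_{x\in X}\|x-\varphi(x)\|_q^p\right)^{1/p}$. Define $d_p[l^q](X,Y)=\inf\{C_p[l^q](\varphi): \varphi:X\to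 Y \text{ a bijection}\}\in[0,\infty]$; a bijection attaining the infimum is called optimal. Let $\mathcal{D}_p[l^q]=\{X\in\mathcal{D}: d_p[l^q](X,\varnothing)<\infty\}$. A geodesic in $\mathcal{D}_p[l^q]$ is a continuous map $\gamma:[0,1]\to\mathcal{D}_p[l^q]$ with $d_p[l^q](\gamma(s),\gamma(t))=|t-s|\,d_p[l^q](\gamma(0),\gamma(1))$ for all $s,t\in[0,1]$; it is a geodesic from $\gamma(0)$ to $\gamma(1)$. A convex-combination geodesic from $X$ to $Y$ is a geodesic of the form $\gamma(0)=X$, $\gamma(1)=Y$, $\gamma(t)=\{(1-t)x+t\varphi(x):x\in X\}$ for $t\in(0,1)$, where $\varphi:X\to Y$ is an optimal bijection; here $\gamma(t)$ is understood as a multiset of geometric points (diagonal with countably infinite multiplicity), the choice of indexing coordinates being immaterial since $d_p[l^q]$ ignores them. *)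

(* Defs.v *)
From mathcomp Require Import all_boot all_order all_algebra.
From mathcomp Require Import all_classical all_reals all_analysis.

Set Implicit Arguments.
Unset Strict Implicit.
Unset Printing Implicit Defensive.

Import Order.TTheory GRing.Theory Num.Theory.

Local Open Scope classical_set_scope.
Local Open Scope ring_scope.

Section PersistenceDiagrams.
Variable R : realType.

(* A geometric component in the plane, paired with an index that only
   distinguishes copies of the same geometric point. *)
Definition dpoint : Type := ((R * R) * nat)%type.

Definition above_diag : set dpoint := [set z | z.1.1 < z.1.2].

Definition diag_copies : set dpoint := [set z | z.1.1 = z.1.2].

(* Only the off-diagonal part is stored: the diagonal copies are common to all
   diagrams and are adjoined in [points]. *)
Record diagram := Diagram {
  offdiag : set dpoint ;
  offdiag_above : offdiag `<=` above_diag ;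
  offdiag_countable : countable offdiag }.

Definition points (X : diagram) : set dpoint := offdiag X `|` diag_copies.

Definition empty_diagram : diagram :=
  @Diagram set0 (@sub0set _ _) (countable0 _).

(* The exponent ranges over [1, +oo]; the value at -oo is junk. *)
Definition qnorm (q : \bar R) (v : R * R) : R :=
  match q with
  | r%:E => (`|v.1| `^ r + `|v.2| `^ r) `^ r^-1
  | +oo%E => Num.max `|v.1| `|v.2|
  | -oo%E => 0
  end.

(* A bijection X -> Y is a function on all of [dpoint] whose restriction to
   [points X] is a bijection onto [points Y]; its other values are irrelevant. *)
Definition diagram_bij (X Y : diagram) (phi : dpoint -> dpoint) : Prop :=
  set_bij (points X) (points Y) phi.

Definition cost (p : R) (q : \bar R) (X : diagram) (phi : dpoint -> dpoint)
    : \bar R :=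
  poweR (\esum_(x in points X) ((qnorm q (x.1 - (phi x).1) `^ p)%R)%:E)%E p^-1.

Definition dist (p : R) (q : \bar R) (X Y : diagram) : \bar R :=
  ereal_inf [set cost p q X phi | phi in diagram_bij X Y].

Definition optimal (p : R) (q : \bar R) (X Y : diagram)
    (phi : dpoint -> dpoint) : Prop :=
  diagram_bij X Y phi /\ cost p q X phi = dist p q X Y.

Definition finite_dist (p : R) (q : \bar R) : set diagram :=
  [set X | (dist p q X empty_diagram < +oo)%E].

(* A map on [0, 1] is a function on R, of which only the values on [0, 1]
   matter. *)
Definition continuous01 (p : R) (q : \bar R) (gamma : R -> diagram) : Prop :=
  forall t : R, 0 <= t <= 1 -> forall e : R, 0 < e ->
  exists2 d : R, 0 < d &
    forall s : R, 0 <= s <= 1 -> `|s - t| < d ->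
      (dist p q (gamma s) (gamma t) < e%:E)%E.

Definition geodesic (p : R) (q : \bar R) (gamma : R -> diagram) : Prop :=
  [/\ forall t : R, 0 <= t <= 1 -> finite_dist p q (gamma t),
      continuous01 p q gamma
    & forall s t : R, 0 <= s <= 1 -> 0 <= t <= 1 ->
        dist p q (gamma s) (gamma t)
        = (`|t - s|%:E * dist p q (gamma 0%R) (gamma 1%R))%E].

Definition geodesic_from_to (p : R) (q : \bar R) (X Y : diagram)
    (gamma : R -> diagram) : Prop :=
  [/\ geodesic p q gamma, gamma 0 = X & gamma 1 = Y].

Definition convex_comb (t : R) (u v : R * R) : R * R :=
  ((1 - t) * u.1 + t * v.1, (1 - t) * u.2 + t * v.2).

(* Z represents the multiset {(1 - t) x + t phi(x) : x in X}, the diagonal being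
   given countably infinite multiplicity.  Diagrams all contain the same
   diagonal copies, so this is an equality of multisets above the diagonal: a
   bijection psi, preserving geometric points, from the x whose combination is
   above the diagonal onto the off-diagonal points of Z.  The indices in Z are
   arbitrary. *)
Definition interpolates (X : diagram) (phi : dpoint -> dpoint) (t : R)
    (Z : diagram) : Prop :=
  let comb x := convex_comb t x.1 (phi x).1 in
  let A := [set x | points X x /\ (comb x).1 < (comb x).2] in
  exists2 psi : dpoint -> dpoint,
    set_bij A (offdiag Z) psi & forall x, A x -> (psi x).1 = comb x.

Definition convex_comb_geodesic (p : R) (q : \bar R) (X Y : diagram)
    (gamma : R -> diagram) : Prop :=
  geodesic_from_to p q X Y gamma /\
  exists2 phi : dpoint -> dpoint, optimal p q X Y phi &
    forall t : R, 0 < t < 1 -> interpolates X phi t (gamma t).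

End PersistenceDiagrams.

(* Main.v *)
(* Write g v = |v|_q^p. In both regimes g is p-homogeneous, continuous and
   strictly convex, so on the compact unit sphere the convexity defect controls
   g (a - b): for every eta there is C with
     g (a - b) <= eta (g a + g b) + C (al g a + be g b - g (al a + be b)).
   Let W be the p-th power of the distance. Fix finitely many times. Composing
   almost optimal bijections between consecutive diagrams of mu gives
   phi : X -> Y of cost at most W(X, Y) + delta factoring through every chosen
   mu t; the weighted convexity inequality replaces Minkowski's inequality here.
   Summing the defect bound shows that the points of mu t are l^p-close to the
   convex combinations of x and phi x.  The same bound at time 1/2 shows that
   points matched to the diagonal go nearly to their orthogonal projections, so
   phi may be replaced by the bijection determined by the partial matching that
   it induces between the finitely many off-diagonal points. There are only
   finitely many such matchings, so one of them serves for all times and all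
   delta: it is optimal, and its convex-combination path is at distance 0 from
   mu. The distance being a pseudometric, that path is itself a geodesic. *)
Require Import Defs.
From mathcomp Require Import all_boot all_order all_algebra.
From mathcomp Require Import all_classical all_reals all_analysis.
From mathcomp Require Import ring lra.

Set Implicit Arguments.
Unset Strict Implicit.
Unset Printing Implicit Defensive.

Import Order.TTheory GRing.Theory Num.Theory.
Import numFieldNormedType.Exports.

Local Open Scope classical_set_scope.
Local Open Scope ring_scope.

(** * Strict convexity of the cost *)

Lemma ltr_ln_sub1 {R : realType} (x : R) : 0 < x -> x != 1 -> ln x < x - 1.
Proof.
move=> x0 x1.
have h : ln x != 0 by rewrite ln_eq0.
by have := expR_gt1Dx h; rewrite lnK ?posrE //; lra.
Qed.

(** Strict Bernoulli inequality. With v = u^p it reads u < 1 + (v - 1)/p, which is strict weighted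
    AM-GM for v and 1 with weights 1/p and 1 - 1/p. *)
Lemma ltr_powR_tangent {R : realType} (p u : R) :
  1 < p -> 0 <= u -> u != 1 -> 1 + p * (u - 1) < u `^ p.
Proof.
move=> p1 u0 u1; have p0 : 0 < p by lra.
move: u0; rewrite le_eqVlt => /orP[/eqP <-|u0].
  by rewrite powR0 ?gt_eqF//; lra.
pose v := u `^ p; have v0 : 0 < v by apply: powR_gt0.
have v1 : v != 1 by rewrite powR_eq1 (negbTE u1) ltNge (ltW u0)/= gt_eqF.
pose A := 1 + (v - 1) / p.
have pV : p^-1 * p = 1 by rewrite mulVf// gt_eqF.
have pV0 : 0 < p^-1 by rewrite invr_gt0.
have pV1 : p^-1 < 1 by rewrite invf_lt1.
have A0 : 0 < A by rewrite /A; nra.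
suff : u < A by rewrite /A -(ltr_pM2l p0) mulrDr mulrCA divff ?gt_eqF//; rewrite -/v; lra.
rewrite -ltr_ln ?posrE//.
have A1 : A != 1.
  by rewrite /A -subr_eq0 addrAC subrr add0r mulf_neq0 ?subr_eq0// invr_neq0// gt_eqF.
have lnu : ln u = p^-1 * ln v by rewrite /v ln_powR mulrA pV mul1r.
(* The tangent bound for [ln] at v/A and at 1/A; by [h3] the weighted mean of these two numbers is
   1, so the right-hand sides cancel. *)
have h1 : ln v - ln A <= v / A - 1.
  rewrite -ln_div ?posrE//; have [->|n] := eqVneq (v / A) 1; first by rewrite ln1 subrr.
  by apply: ltW; apply: ltr_ln_sub1 => //; rewrite divr_gt0.
have h2 : - ln A < A^-1 - 1.
  rewrite -lnV ?posrE//; apply: ltr_ln_sub1; first by rewrite invr_gt0.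
  by rewrite invr_eq1.
have h3 : p^-1 * (v / A) + (1 - p^-1) * A^-1 = 1.
  by rewrite mulrA -mulrDl -[RHS](divff (lt0r_neq0 A0)) /A; congr (_ / _); ring.
have h4 : p^-1 * (ln v - ln A) <= p^-1 * (v / A - 1) by rewrite ler_pM2l.
have h5 : (1 - p^-1) * (- ln A) < (1 - p^-1) * (A^-1 - 1) by rewrite ltr_pM2l// subr_gt0.
rewrite lnu; lra.
Qed.

(** The tangent at the weighted mean [m] lies strictly below the power at any other point; averaging
    over [r] and [s] cancels the linear terms. *)
Lemma powR_strictly_convex {R : realType} (p al be r s : R) : 1 < p ->
  0 < al -> 0 < be -> al + be = 1 -> 0 <= r -> 0 <= s ->
  (al * r + be * s) `^ p <= al * r `^ p + be * s `^ p ?= iff (r == s).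
Proof.
move=> p1 al0 be0 ab r0 s0; have p0 : 0 < p by lra.
have [<-|rs] := eqVneq r s.
  by rewrite -!mulrDl ab !mul1r; apply/leifP; rewrite eqxx.
apply/leifP => /=.
pose m := al * r + be * s; rewrite -/m.
have m0 : 0 < m.
  rewrite lt0r /m addr_ge0 ?mulr_ge0 ?(ltW al0) ?(ltW be0)// andbT.
  rewrite paddr_eq0 ?mulr_ge0 ?(ltW al0) ?(ltW be0)// !mulf_eq0 !(gt_eqF al0) !(gt_eqF be0)/=.
  by apply: contraNN rs => /andP[/eqP -> /eqP ->].
have mV : m^-1 * m = 1 by rewrite mulVf ?gt_eqF.
have hm (x : R) : 0 <= x -> x != m -> m `^ p * (1 + p * (x / m - 1)) < x `^ p.
  move=> x0 xm; rewrite -{2}(divfK (lt0r_neq0 m0) x) [(x / m * m) `^ p]powRM ?(ltW m0)//; last first.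
    by rewrite divr_ge0// ltW.
  rewrite mulrC ltr_pM2r ?powR_gt0//; apply: ltr_powR_tangent => //; first by rewrite divr_ge0// ltW.
  by apply: contraNN xm => /eqP /divr1_eq ->.
have rm : r != m.
  apply: contraNN rs => /eqP e; apply/eqP.
  have : be * (s - r) = 0 by move: e; rewrite /m (_ : al = 1 - be); [lra|lra].
  by move/eqP; rewrite mulf_eq0 (gt_eqF be0)/= subr_eq0 => /eqP.
have sm : s != m.
  apply: contraNN rs => /eqP e; apply/eqP.
  have : al * (r - s) = 0 by move: e; rewrite /m (_ : be = 1 - al); [lra|lra].
  by move/eqP; rewrite mulf_eq0 (gt_eqF al0)/= subr_eq0 => /eqP.
have h1 : al * (m `^ p * (1 + p * (r / m - 1))) < al * r `^ p by rewrite ltr_pM2l// hm.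
have h2 : be * (m `^ p * (1 + p * (s / m - 1))) < be * s `^ p by rewrite ltr_pM2l// hm.
apply: le_lt_trans (ltrD h1 h2); rewrite le_eqVlt; apply/orP; left; apply/eqP.
have -> : al * (m `^ p * (1 + p * (r / m - 1))) + be * (m `^ p * (1 + p * (s / m - 1)))
  = m `^ p * ((al + be) * (1 - p) + p * (m^-1 * (al * r + be * s))) by ring.
by rewrite -/m mV ab; ring.
Qed.

Lemma norm_powR_continuous {R : realType} (p : R) : 1 < p ->
  continuous (fun x : R => `|x| `^ p).
Proof.
move=> p1 x; have p0 : 0 < p by lra.
(* Powers are differentiated at positive bases only; at 0 continuity follows from |y|^p <= |y| for
   |y| <= 1. *)
have [->|x0] := eqVneq x 0.
  rewrite /continuous_at normr0 powR0 ?gt_eqF//.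
  apply/cvgr0Pnorm_lt => e e0; near=> y.
  rewrite ger0_norm ?powR_ge0//.
  have [->|y0] := eqVneq y 0; first by rewrite normr0 powR0 ?gt_eqF.
  apply: (@le_lt_trans _ _ `|y|).
    apply: ge1r_powR; last exact: ltW.
    rewrite normr_gt0 y0/=; near: y.
    by apply: (@cvgr0_norm_le _ _ _ (nbhs (0 : R)) _ id) => //; exact: cvg_id.
  by near: y; apply: (@cvgr0_norm_lt _ _ _ (nbhs (0 : R)) _ id) => //; exact: cvg_id.
apply: (@continuous_comp R R R (fun y => `|y|) (fun y : R => y `^ p)).
  exact: norm_continuous.
apply: differentiable_continuous; apply/derivable1_diffP.
by apply: derivable_powR; rewrite in_itv/= andbT normr_gt0.
Unshelve. all: by end_near. Qed.

(** * Strict convexity of powers of the Euclidean norm *)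

Section EuclideanNorm.
Context {R : realType}.
Implicit Types a b v : R * R.

Definition norm2 v : R := Num.sqrt (v.1 ^+ 2 + v.2 ^+ 2).

Lemma norm2_ge0 v : 0 <= norm2 v. Proof. exact: sqrtr_ge0. Qed.

Lemma norm2_sqr v : norm2 v ^+ 2 = v.1 ^+ 2 + v.2 ^+ 2.
Proof. by rewrite sqr_sqrtr// addr_ge0// sqr_ge0. Qed.

Lemma norm2Z c v : norm2 (c *: v) = `|c| * norm2 v.
Proof.
by rewrite /norm2/= !exprMn -mulrDr sqrtrM ?sqr_ge0// sqrtr_sqr.
Qed.

Lemma norm2_real (c : R) : norm2 (c, 0) = `|c|.
Proof. by rewrite /norm2/= expr0n/= addr0 sqrtr_sqr. Qed.

Lemma norm2_continuous : continuous norm2.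
Proof.
move=> v; apply: (@continuous_comp _ _ _ (fun v => v.1 ^+ 2 + v.2 ^+ 2) Num.sqrt).
  by apply: cvgD; apply: cvgM; (exact: cvg_fst || exact: cvg_snd).
exact: sqrt_continuous.
Qed.

Lemma dot_le_norm2 a b : a.1 * b.1 + a.2 * b.2 <= norm2 a * norm2 b.
Proof.
apply: le_trans (ler_norm _) _; rewrite -ler_sqr ?nnegrE ?mulr_ge0 ?norm2_ge0//.
rewrite real_normK ?num_real// exprMn !norm2_sqr -subr_ge0.
rewrite (_ : _ - _ = (a.1 * b.2 - a.2 * b.1) ^+ 2) ?sqr_ge0//; ring.
Qed.

(** The last factor is the Cauchy-Schwarz gap: it measures how far the triangle inequality is from
    equality. *)
Lemma norm2_comb_sqr al be a b : norm2 (al *: a + be *: b) ^+ 2 =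
  (al * norm2 a + be * norm2 b) ^+ 2
  - 2 * al * be * (norm2 a * norm2 b - (a.1 * b.1 + a.2 * b.2)).
Proof.
transitivity (al ^+ 2 * norm2 a ^+ 2 + be ^+ 2 * norm2 b ^+ 2
    + 2 * al * be * (a.1 * b.1 + a.2 * b.2)); last by ring.
by rewrite !norm2_sqr /= /GRing.scale/=; ring.
Qed.

Lemma norm2_convex al be a b : 0 <= al -> 0 <= be ->
  norm2 (al *: a + be *: b) <= al * norm2 a + be * norm2 b.
Proof.
move=> al0 be0; rewrite -ler_sqr ?nnegrE ?addr_ge0 ?mulr_ge0 ?norm2_ge0//.
by rewrite norm2_comb_sqr gerBl ?mulr_ge0// subr_ge0 dot_le_norm2.
Qed.

(** Different norms give strictness through the scalar power; equal norms of distinct vectors give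
    it through Cauchy-Schwarz. *)
Lemma norm2_powR_convex p al be a b : 1 < p -> 0 < al -> 0 < be -> al + be = 1 ->
  norm2 (al *: a + be *: b) `^ p <= al * norm2 a `^ p + be * norm2 b `^ p
    ?= iff (a == b).
Proof.
move=> p1 al0 be0 ab; have p0 : 0 < p by lra.
have := powR_strictly_convex p1 al0 be0 ab (norm2_ge0 a) (norm2_ge0 b).
have h : norm2 (al *: a + be *: b) `^ p <= (al * norm2 a + be * norm2 b) `^ p.
  apply: ge0_ler_powR; rewrite ?nnegrE ?(ltW p0) ?norm2_ge0//.
    by rewrite addr_ge0// mulr_ge0 ?norm2_ge0// ltW.
  by apply: norm2_convex; exact: ltW.
move=> h2; have [<-|n] := eqVneq a b.
  by apply/leifP => /=; rewrite -scalerDl -mulrDl ab scale1r mul1r.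
move: h2; have [e h2|n2 h2] := eqVneq (norm2 a) (norm2 b); last first.
  apply/leifP; rewrite /=; apply: le_lt_trans h _.
  by move/leifP: h2.
apply/leifP; rewrite /=; apply: lt_le_trans h2.
apply: gt0_ltr_powR; rewrite ?nnegrE ?norm2_ge0//.
  by rewrite addr_ge0// mulr_ge0 ?norm2_ge0// ltW.
rewrite -ltr_sqr ?nnegrE ?norm2_ge0//; last first.
  by rewrite addr_ge0// mulr_ge0 ?norm2_ge0// ltW.
rewrite norm2_comb_sqr gtrBl; apply: mulr_gt0; first by rewrite !mulr_gt0.
rewrite -e -expr2 norm2_sqr; have := norm2_sqr a; rewrite e norm2_sqr.
move: n; clear h; case: a e => a1 a2; case: b => b1 b2 /= _ n eab.
(* For equal norms the Cauchy-Schwarz gap is half of |a - b|^2. *)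
suff : 0 < (a1 - b1) ^+ 2 + (a2 - b2) ^+ 2 by move: eab; rewrite !sqrrD !sqrrN; lra.
rewrite lt0r addr_ge0 ?sqr_ge0// andbT paddr_eq0 ?sqr_ge0// !sqrf_eq0 !subr_eq0.
by apply: contra n => /andP[/eqP -> /eqP ->].
Qed.

End EuclideanNorm.

(** Common ground of the two regimes: the estimates below know the cost only through these
    properties. [cost_swap] is invariance under reflection in the diagonal. *)
Record convex_cost {R : realType} (p : R) (g : R * R -> R) : Prop := ConvexCost {
  cost_ge0 : forall v, 0 <= g v ;
  costZ : forall c v, g (c *: v) = `|c| `^ p * g v ;
  cost_swap : forall v, g (v.2, v.1) = g v ;
  cost_continuous : continuous g ;
  cost_convex : forall al be a b, 0 < al -> 0 < be -> al + be = 1 ->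
    g (al *: a + be *: b) <= al * g a + be * g b ?= iff (a == b) }.

Definition diag_proj {R : realType} (v : R * R) : R * R :=
  ((v.1 + v.2) / 2, (v.1 + v.2) / 2).

(** Quantitative uniqueness of the nearest diagonal point: if [d] is almost as cheap as the
    projection, then it is close to it, up to an [eta] fraction of its cost. *)
Definition diag_modulus {R : realType} (g : R * R -> R) (eta C : R) : Prop :=
  forall v d : R * R, d.1 = d.2 ->
    g (v - diag_proj v) <= g (v - d) /\
    g (diag_proj v - d) <= eta * g (v - d) + C * (g (v - d) - g (v - diag_proj v)).

Lemma qnorm2E {R : realType} (v : R * R) : qnorm 2%:E v = norm2 v.
Proof.
rewrite /qnorm/= powR12_sqrt; last by rewrite addr_ge0// powR_ge0.
by rewrite !powR_mulrn// !real_normK ?num_real.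
Qed.

(** Coordinates are placed on an axis, so that the Euclidean convexity lemma serves the case p = q
    coordinatewise. *)
Lemma qnorm_powRE {R : realType} (p : R) (v : R * R) : 1 < p ->
  qnorm p%:E v `^ p = norm2 (v.1, 0) `^ p + norm2 (v.2, 0) `^ p.
Proof.
move=> p1; rewrite /qnorm -powRrM mulVf ?gt_eqF ?powRr1 ?addr_ge0 ?powR_ge0 ?norm2_real//.
by lra.
Qed.

Lemma euclidean_convex_cost {R : realType} (p : R) : 1 < p ->
  convex_cost p (fun v : R * R => norm2 v `^ p).
Proof.
move=> p1; split.
- by move=> v; rewrite powR_ge0.
- by move=> c v; rewrite norm2Z powRM// norm2_ge0.
- by move=> v; rewrite /norm2/= addrC.
- move=> v; rewrite (_ : (fun v => _) = (fun x => `|x| `^ p) \o norm2); last first.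
    by apply/funext => w /=; rewrite ger0_norm// norm2_ge0.
  by apply: continuous_comp; [exact: norm2_continuous|exact: norm_powR_continuous].
- by move=> *; exact: norm2_powR_convex.
Qed.

Lemma lp_convex_cost {R : realType} (p : R) : 1 < p ->
  convex_cost p (fun v : R * R => norm2 (v.1, 0) `^ p + norm2 (v.2, 0) `^ p).
Proof.
move=> p1; split.
- by move=> v; rewrite addr_ge0// powR_ge0.
- by move=> c v; rewrite !norm2_real /= !normrM !powRM// mulrDr.
- by move=> v /=; rewrite addrC.
- move=> v; under eq_fun do rewrite !norm2_real.
  apply: cvgD.
    apply: (@continuous_comp _ _ _ fst (fun x : R => `|x| `^ p)); first exact: cvg_fst.
    exact: norm_powR_continuous.
  apply: (@continuous_comp _ _ _ snd (fun x : R => `|x| `^ p)); first exact: cvg_snd.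
  exact: norm_powR_continuous.
- move=> al be a b al0 be0 ab.
  have h1 := norm2_powR_convex (a.1, 0) (b.1, 0) p1 al0 be0 ab.
  have h2 := norm2_powR_convex (a.2, 0) (b.2, 0) p1 al0 be0 ab.
  have := leifD h1 h2; rewrite !xpair_eqE !eqxx !andbT/=.
  rewrite (_ : (a.1 == b.1) && _ = (a == b)); last by case: (a); case: (b).
  have e (x y : R) : norm2 (al *: (x, 0) + be *: (y, 0)) = norm2 (al *: x + be *: y, 0 : R).
    by congr norm2; apply/pair_equal_spec; split => //=; rewrite !scaler0 addr0.
  by rewrite !e [X in _ <= X ?= iff _]addrACA -!mulrDr.
Qed.

Lemma qnorm_convex_cost {R : realType} (p : R) (q : \bar R) :
  (q = p%:E /\ 2 <= p) \/ (q = 2%:E /\ 1 < p) ->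
  1 < p /\ convex_cost p (fun v => qnorm q v `^ p).
Proof.
case=> -[-> hp]; have p1 : 1 < p by lra.
  split; first exact: p1.
  rewrite (_ : (fun v => _) = fun v => norm2 (v.1, 0) `^ p + norm2 (v.2, 0) `^ p).
    exact: lp_convex_cost.
  by apply/funext => v; exact: qnorm_powRE.
split; first exact: p1.
  rewrite (_ : (fun v => _) = fun v => norm2 v `^ p).
  exact: euclidean_convex_cost.
by apply/funext => v; rewrite qnorm2E.
Qed.

(** * Uniform control of differences by the convexity defect *)

Section ConvexCost.
Context {R : realType} (p : R) (g : R * R -> R).
Hypotheses (p1 : 1 < p) (hg : convex_cost p g).
Implicit Types (a b v : R * R).

Let p_gt0 : 0 < p. Proof. exact: lt_trans ltr01 p1. Qed.
Hint Resolve p_gt0 : core.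

Lemma cost0 : g 0 = 0.
Proof. by rewrite -(scale0r (0 : R * R)) (costZ hg) normr0 powR0 ?mul0r// gt_eqF. Qed.

Lemma costN v : g (- v) = g v.
Proof. by rewrite -scaleN1r (costZ hg) normrN normr1 powR1 mul1r. Qed.

Lemma costC a b : g (a - b) = g (b - a).
Proof. by rewrite -costN opprB. Qed.

Lemma costZ_le c v : `|c| <= 1 -> g (c *: v) <= g v.
Proof.
move=> c1; rewrite (costZ hg) ler_piMl// ?(cost_ge0 hg)//.
have <- : 1 `^ p = 1 :> R by rewrite powR1.
by apply: ge0_ler_powR; rewrite ?nnegrE// ltW.
Qed.

Lemma cost_eq0 v : g v = 0 -> v = 0.
Proof.
move=> gv; have h : (2^-1 + 2^-1 : R) = 1 by lra.
have h2 : 0 < (2^-1 : R) by lra.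
have := cost_convex hg v 0 h2 h2 h.
by rewrite scaler0 addr0 cost0 (costZ hg) gv !mulr0 addr0 => /leifP; case: eqVneq => //; rewrite ltxx.
Qed.

Lemma costV (c : R) v : 0 < c -> c * g (c^-1 *: v) = c `^ (1 - p) * g v.
Proof.
move=> c0; rewrite (costZ hg) mulrA gtr0_norm ?invr_gt0//; congr (_ * _).
have cp : c^-1 `^ p = (c `^ p)^-1 by rewrite -powR_inv1 ?ltW// -powRrM mulN1r powRN.
by rewrite powRB ?(gt_eqF c0) ?implybT// powRr1 ?ltW// cp.
Qed.

(** Convexity at a/al and b/be, rescaled by homogeneity. *)
Lemma costD_weighted al be a b : 0 < al -> 0 < be -> al + be = 1 ->
  g (a + b) <= al `^ (1 - p) * g a + be `^ (1 - p) * g b.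
Proof.
move=> al0 be0 ab.
rewrite -!costV//; have := cost_convex hg (al^-1 *: a) (be^-1 *: b) al0 be0 ab.
by rewrite !scalerA !divff ?gt_eqF// !scale1r => /leifP; case: ifP => _ => [/eqP|/ltW]; lra.
Qed.

(** By homogeneity unit vectors suffice. Wherever the [eta] term alone is too small, compactness
    bounds the defect away from 0. *)
Lemma cost_modulus al be eta : 0 < al -> 0 < be -> al + be = 1 -> 0 < eta ->
  exists2 C, 0 <= C & forall a b, g (a - b) <= eta * (g a + g b)
    + C * (al * g a + be * g b - g (al *: a + be *: b)).
Proof.
move=> al0 be0 ab eta0.
pose D (w : (R * R) * (R * R)) := al * g w.1 + be * g w.2 - g (al *: w.1 + be *: w.2).
have D0 w : 0 <= D w.
  by rewrite subr_ge0; have /leifP := cost_convex hg w.1 w.2 al0 be0 ab; case: ifP => _ => [/eqP ->|/ltW].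
have cf1 (f : (R * R) * (R * R) -> R * R) : continuous f -> continuous (g \o f).
  by move=> cf w; apply: continuous_comp; [exact: cf|exact: (cost_continuous hg)].
have c1 : continuous (fun w : (R * R) * (R * R) => g w.1) by apply: cf1 => w; exact: cvg_fst.
have c2 : continuous (fun w : (R * R) * (R * R) => g w.2) by apply: cf1 => w; exact: cvg_snd.
have c3 : continuous (fun w : (R * R) * (R * R) => g (w.1 - w.2)).
  by apply: cf1 => w; apply: cvgB; [exact: cvg_fst|exact: cvg_snd].
have c4 : continuous (fun w : (R * R) * (R * R) => eta * (g w.1 + g w.2)).
  move=> w; apply: cvgM; first exact: cvg_cst.
  by apply: cvgD; [exact: c1|exact: c2].
have cD : continuous D.
  move=> w; apply: cvgB; first by apply: cvgD; apply: cvgM; (exact: cvg_cst || exact: c1 || exact: c2).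
  apply: (cf1 (fun w => al *: w.1 + be *: w.2)) => {}w.
  by apply: cvgD; apply: cvgZ; [exact: cvg_cst|exact: cvg_fst|exact: cvg_cst|exact: cvg_snd].
pose S := [set w : (R * R) * (R * R) | `|w| = 1].
have cS : compact S.
  pose I : set R := `[-1, 1]%classic.
  pose B : set ((R * R) * (R * R)) := (I `*` I) `*` (I `*` I).
  apply: (@subclosed_compact _ S B).
  - rewrite /S (_ : [set w | _] = (fun w => `|w|) @^-1` [set 1])//.
    by apply: preimage_closed; [move=> w _; exact: norm_continuous|exact: closed_eq].
  - by do 2 apply: compact_setX; exact: segment_compact.
  - move=> [[x1 x2] [x3 x4]]; rewrite /S/= !prod_normE/= => h.
    rewrite /B/I/= !in_itv/= -!ler_norml -h !le_max !lexx ?orbT//.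
(* On the sphere outside [K] the [eta] term already dominates. *)
pose K := S `&` [set w | eta * (g w.1 + g w.2) <= g (w.1 - w.2)].
have cK : compact K.
  apply: compact_closedI => //.
  rewrite (_ : [set w | _] = (fun w => g (w.1 - w.2) - eta * (g w.1 + g w.2)) @^-1` [set x | 0 <= x]).
    apply: preimage_closed; last exact: closed_ge.
    by move=> w _; apply: cvgB; [exact: c3|exact: c4].
  by apply/seteqP; split=> w /=; rewrite subr_ge0.
have [C C0 hC] : exists2 C, 0 <= C & forall w, K w -> g (w.1 - w.2) <= C * D w.
  have [K0|/set0P K0] := eqVneq K set0.
    by exists 0 => // w; rewrite K0.
  have [m mK hm] := compact_EVT_min K0 cK (continuous_subspaceT cD).
  have [M MK hM] := compact_EVT_max K0 cK (continuous_subspaceT c3).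
  (* A zero defect forces equal components; membership in [K] then makes their cost vanish, but the
     origin is not on the sphere. *)
  have Dm : 0 < D m.
    rewrite lt0r D0 andbT subr_eq0 eq_sym; apply/eqP => e.
    have [_] := cost_convex hg m.1 m.2 al0 be0 ab.
    rewrite e eqxx => /esym/eqP mm.
    move: mK; rewrite inE => -[mS]; rewrite /= mm subrr cost0 pmulr_rle0// => h.
    have g0 : g m.2 = 0 by have := cost_ge0 hg m.2; lra.
    move: mS; rewrite /S/= (_ : m = 0) ?normr0; first by move/eqP; rewrite eq_sym oner_eq0.
    by move/cost_eq0 : g0 mm; case: (m) => x y /= -> ->.
  exists (g (M.1 - M.2) / D m); first by rewrite divr_ge0 ?(cost_ge0 hg).
  move=> w Kw; apply: (le_trans (hM w (mem_set Kw))).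
  by rewrite mulrAC -mulrA ler_peMr ?(cost_ge0 hg)// ler_pdivlMr// mul1r hm// inE.
exists C => // a b; have [/eqP|n] := eqVneq (a, b) 0.
  rewrite xpair_eqE => /andP[/eqP -> /eqP ->].
  by rewrite !scaler0 !addr0 subrr cost0 !(mulr0, addr0, subrr).
pose c := `|(a, b)|^-1; have c0 : 0 < c by rewrite invr_gt0 normr_gt0.
have Sw : S (c *: a, c *: b).
  by rewrite /S/= -[X in `|X|]/(c *: (a, b)) normrZ gtr0_norm// mulVf// normr_eq0.
have gc v : g (c *: v) = c `^ p * g v by rewrite (costZ hg) gtr0_norm.
have P0 : 0 < c `^ p := powR_gt0 p c0.
rewrite -(ler_pM2l P0).
have key : g (c *: a - c *: b) <= eta * (g (c *: a) + g (c *: b)) + C * D (c *: a, c *: b).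
  have [Kw|nKw] := pselect (K (c *: a, c *: b)).
    apply: (le_trans (hC _ Kw)); rewrite lerDr mulr_ge0 ?addr_ge0 ?(cost_ge0 hg)//; exact: ltW.
  have [h|h] := leP (g (c *: a - c *: b)) (eta * (g (c *: a) + g (c *: b))).
    by apply: (le_trans h); rewrite lerDl mulr_ge0.
  by exfalso; apply: nKw; split => //=; exact: ltW.
have eD : D (c *: a, c *: b) = c `^ p * (al * g a + be * g b - g (al *: a + be *: b)).
  rewrite /D/= !gc (_ : al *: (c *: a) + be *: (c *: b) = c *: (al *: a + be *: b)) ?gc; last first.
    by rewrite scalerDr !scalerA (mulrC al) (mulrC be).
  by ring.
move: key; rewrite eD -scalerBr !gc; congr (_ <= _); ring.
Qed.

Lemma cost_diag_modulus eta : 0 < eta ->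
  exists2 C, 0 <= C & diag_modulus g eta C.
Proof.
move=> eta0; have h : (2^-1 + 2^-1 : R) = 1 by lra.
have h2 : 0 < (2^-1 : R) by lra.
have eta2 : 0 < eta / 2 by lra.
have [C C0 hC] := cost_modulus h2 h2 h eta2.
(* Averaging with the mirror image in the diagonal shows that the midpoint projection is nearest. *)
have proj (v d : R * R) : d.1 = d.2 ->
    g (v - diag_proj v) <= g (v - d).
  move=> dd; pose w := - ((v - d).2, (v - d).1).
  have gw : g w = g (v - d) by rewrite /w costN (cost_swap hg).
  have -> : v - diag_proj v = 2^-1 *: (v - d) + 2^-1 *: w.
    by case: v d dd @w gw => a b [c d] /= -> _; apply: injective_projections;
      rewrite /= /GRing.scale/=; lra.
  have [+ _] := cost_convex hg (v - d) w h2 h2 h.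
  by rewrite gw; lra.
exists (C / 2) => [|v d dd]; first by lra.
pose m := diag_proj v; rewrite -/m.
have pm := proj v d dd; split => //; rewrite -/m in pm.
(* The midpoint of v - d and v - m is v minus a diagonal point, so by [proj] the defect is at most
   half of g (v - d) - g (v - m); hence the constant [C / 2]. *)
have := hC (v - d) (v - m).
rewrite (_ : v - d - (v - m) = m - d); last by rewrite opprB addrC addrA subrK.
rewrite (_ : 2^-1 *: (v - d) + 2^-1 *: (v - m) = v - 2^-1 *: (d + m)); last first.
  by apply: injective_projections; rewrite /= /GRing.scale/=; lra.
have := proj v (2^-1 *: (d + m)); rewrite -/m /= dd => /(_ erefl); nra.
Qed.

End ConvexCost.

(** * Diagrams represented by indexed families *)

Section SetBijections.

Lemma set_bijP T U (A : set T) (B : set U) (f : T -> U) :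
  (forall x, A x -> B (f x)) ->
  (forall x y, A x -> A y -> f x = f y -> x = y) ->
  (forall y, B y -> exists2 x, A x & f x = y) -> set_bij A B f.
Proof.
move=> fun_f inj_f surj_f; split => //.
by move=> x y /[!inE]; exact: inj_f.
Qed.

Lemma set_bijE T U (A : set T) (B : set U) (f : T -> U) : set_bij A B f ->
  [/\ forall x, A x -> B (f x),
      forall x y, A x -> A y -> f x = f y -> x = y
    & forall y, B y -> exists2 x, A x & f x = y].
Proof.
by case=> fun_f inj_f surj_f; split => // x y Ax Ay; apply: inj_f; rewrite inE.
Qed.

Lemma set_bij_inverse T U (A : set T) (B : set U) (f : T -> U) (x0 : T) :
  set_bij A B f -> exists g, [/\ set_bij B A g,
    forall x, A x -> g (f x) = x & forall y, B y -> f (g y) = y].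
Proof.
move=> /(@set_bijE _ _ _ _ _)[fun_f inj_f surj_f].
have /choice[g hg] : forall y, exists x, B y -> A x /\ f x = y.
  move=> y; have [/surj_f[x Ax <-]|nBy] := pselect (B y); last by exists x0.
  by exists x.
have gB y : B y -> A (g y) by move=> /hg[].
have fg y : B y -> f (g y) = y by move=> /hg[].
have gf x : A x -> g (f x) = x.
  by move=> Ax; apply: inj_f => //; [apply: gB|apply: fg]; exact: fun_f.
exists g; split => //; apply: set_bijP => //.
  by move=> x y Bx By e; rewrite -(fg x)// e fg.
by move=> x Ax; exists (f x); [exact: fun_f|exact: gf].
Qed.

End SetBijections.

Section Families.
Context {R : realType}.
Implicit Types X Y Z : diagram R.

Definition above (v : R * R) := v.1 < v.2.

(* The points [u i], [i \in I], form the multiset [X], up to the diagonal. *)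
Definition represents J (I : set J) (u : J -> R * R) X :=
  (forall i, I i -> (u i).1 <= (u i).2) /\
  exists2 psi : J -> dpoint R,
    set_bij [set i | I i /\ above (u i)] (offdiag X) psi &
    forall i, I i -> above (u i) -> (psi i).1 = u i.

Lemma points_le X x : points X x -> x.1.1 <= x.1.2.
Proof. by case=> [/offdiag_above /ltW//|/= ->]. Qed.

Lemma offdiag_points X x : offdiag X x <-> points X x /\ above x.1.
Proof.
split=> [Xx|[[//|/= e]]]; last by rewrite /above e ltxx.
by split; [left|exact: offdiag_above Xx].
Qed.

Lemma represents_points X Z phi : diagram_bij X Z phi ->
  represents (points X) (fun x => (phi x).1) Z.
Proof.
move=> /(@set_bijE _ _ _ _ _)[hf hi hs]; split; first by move=> x /hf; exact: points_le.
exists phi => //; apply: set_bijP.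
- by move=> x [/hf Xx ax]; apply/offdiag_points.
- by move=> x y [Xx _] [Xy _]; exact: hi.
- move=> z /offdiag_points[/hs[x Xx <-] az]; exists x => //.
Qed.

(** Indices in [B] outside [A] carry diagonal points only, so they leave the represented multiset
    unchanged. *)
Lemma represents_reindex J J' (I : set J) (A B : set J') (theta : J' -> J) w w' Z :
  represents I w Z -> set_bij A I theta -> A `<=` B ->
  (forall x, A x -> w' x = w (theta x)) ->
  (forall x, B x -> ~ A x -> (w' x).1 = (w' x).2) ->
  represents B w' Z.
Proof.
move=> [wI [psi /(@set_bijE _ _ _ _ _)[pf pi ps] hpsi]] /(@set_bijE _ _ _ _ _)[tf ti ts] AB hA hB; split.
  move=> x Bx; have [Ax|/(hB x Bx) ->//] := pselect (A x).
  by rewrite hA//; apply: wI; exact: tf.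
have inA x : B x -> above (w' x) -> A x.
  by move=> Bx; rewrite /above => ax; apply: contrapT => /(hB x Bx) e; rewrite e ltxx in ax.
exists (psi \o theta); last first.
  move=> x Bx ax; have Ax := inA x Bx ax.
  by rewrite /= hpsi ?hA//; [exact: tf|rewrite -hA].
apply: set_bijP.
- move=> x [Bx ax]; have Ax := inA x Bx ax.
  by apply: pf; split; [exact: tf|rewrite -hA].
- move=> x y [Bx ax] [By ay] /=; have Ax := inA x Bx ax; have Ay := inA y By ay.
  move=> /pi e; apply: ti => //; apply: e; split; rewrite -?hA//; exact: tf.
- move=> z /ps[i [Ii ai] <-]; have [x Ax xi] := ts i Ii.
  by exists x; [split; [exact: AB|rewrite hA ?xi]|rewrite /= xi].
Qed.

Lemma represents_sub J (I I0 : set J) u X : represents I u X -> I0 `<=` I ->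
  (forall i, I i -> ~ I0 i -> ~~ above (u i)) -> represents I0 u X.
Proof.
move=> [uI [psi hpsi e]] I0I off; split; first by move=> i /I0I; exact: uI.
exists psi; last by move=> i /I0I; exact: e.
rewrite (_ : [set i | _] = [set i | I i /\ above (u i)])//.
apply/seteqP; split=> i [Ii ai]; split => //; first exact: I0I.
by apply: contrapT => /(off _ Ii); rewrite ai.
Qed.

Lemma represents_countable J (I : set J) u X : represents I u X ->
  countable [set i | I i /\ above (u i)].
Proof.
move=> [_ [psi /(@set_bijE _ _ _ _ _)[pf pi _] _]].
have [f hf] := countable_injP _ (offdiag_countable X).
apply/countable_injP; exists (f \o psi) => i j /[!inE] hi hj /= /hf e.
by apply: pi => //; apply: e; rewrite inE; exact: pf.
Qed.

Lemma represents_countableU J (I : set J) u v X Y :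
  represents I u X -> represents I v Y ->
  (forall i, I i -> above (u i) \/ above (v i)) -> countable I.
Proof.
move=> rX rY uv.
rewrite (_ : I = [set i | I i /\ above (u i)] `|` [set i | I i /\ above (v i)]).
  rewrite -bigcup2inE; apply: bigcup_countable => // -[|[|//]] _ /=.
    exact: represents_countable rX.
  exact: represents_countable rY.
apply/seteqP; split=> i; last by case=> -[].
by move=> Ii; have [?|?] := uv i Ii; [left|right].
Qed.

Lemma represents_exists J (I : set J) u : countable I ->
  (forall i, I i -> (u i).1 <= (u i).2) -> exists X, represents I u X.
Proof.
move=> /countable_injP[f hf] uI.
(* The numbering [f] of [I] becomes the index coordinate and keeps equal geometric points apart. *)
pose A := [set i | I i /\ above (u i)]; pose psi i : dpoint R := (u i, f i).
have above_psi : psi @` A `<=` above_diag (R := R) by move=> _ [i [_ ai] <-].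
have psi_inj : {in A &, injective psi}.
  by move=> i j /[!inE] -[Ii _] [Ij _] [_ /hf]; apply; rewrite inE.
have cA : countable (psi @` A).
  apply/countable_injP; exists snd => _ _ /[!inE] -[i [Ii _] <-] [j [Ij _] <-] /=.
  by move=> /hf -> //; rewrite inE.
exists (Diagram above_psi cA); split => //; exists psi => //; exact: inj_bij.
Qed.

(* The unmatched copies of each diagonal point are kept infinite in number by
   using only even indices. *)
Lemma represents_embedding J (I : set J) u X : countable I -> represents I u X ->
  exists kappa : J -> dpoint R,
    [/\ forall i j, I i -> I j -> kappa i = kappa j -> i = j,
        forall i, I i -> points X (kappa i) /\ (kappa i).1 = u i,
        offdiag X `<=` kappa @` I
      & forall c : R, infinite_set [set n | ~ (kappa @` I) ((c, c), n)]].
Proof.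
move=> /countable_injP[f hf] [uI [psi /(@set_bijE _ _ _ _ _)[pf pi ps] e]].
pose kappa i : dpoint R := if above (u i) then psi i else (u i, (f i).*2).
have kX i : I i -> points X (kappa i) /\ (kappa i).1 = u i.
  move=> Ii; rewrite /kappa; have [ai|nai] := ifPn.
    by split; [left; exact: pf|exact: e].
  split => //; right; rewrite /diag_copies/=; apply/eqP; rewrite eq_le uI//=.
  by rewrite leNgt.
exists kappa; split => //.
- move=> i j Ii Ij ij; have uij : u i = u j.
    by rewrite -(kX i Ii).2 -(kX j Ij).2 ij.
  move: ij; rewrite /kappa -uij; case: ifP => ai; first by apply: pi; rewrite /= -?uij.
  by move=> [] /(congr1 half); rewrite !doubleK => /hf; apply; rewrite inE.
- move=> x /ps[i [Ii ai] <-]; exists i => //; by rewrite /kappa ai.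
move=> c; apply: (@sub_infinite_set _ [set n | odd n]).
  move=> n /= on [i Ii]; rewrite /kappa; case: ifP => [ai ei|_ [_ en]].
    by have := e i Ii ai; rewrite ei /= => uE; move: ai; rewrite -uE /above ltxx.
  by move: on; rewrite -en odd_double.
apply/infiniteP/pcard_leP/injfunPex; exists (fun n => n.*2.+1).
  by move=> n _ /=; rewrite odd_double.
by move=> m n _ _ [] /(congr1 half); rewrite !doubleK.
Qed.

Lemma common_family_bij J (I : set J) u v X Y : countable I ->
  represents I u X -> represents I v Y ->
  exists F (kappa : J -> dpoint R),
    [/\ diagram_bij X Y F,
        forall i j, I i -> I j -> kappa i = kappa j -> i = j,
        forall i, I i -> [/\ points X (kappa i), (kappa i).1 = u i & (F (kappa i)).1 = v i]
      & forall x, points X x -> ~ (kappa @` I) x -> x.1.1 = x.1.2 /\ (F x).1 = x.1].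
Proof.
move=> cI rX rY.
have [ka [ki kX kO kinf]] := represents_embedding cI rX.
have [la [li lY lO linf]] := represents_embedding cI rY.
have /choice[h hh] : forall c : R, exists f : nat -> nat,
    set_bij [set n | ~ (ka @` I) ((c, c), n)] [set n | ~ (la @` I) ((c, c), n)] f.
  move=> c; apply/card_set_bijP.
  have hk := eq_card_nat (countableP _) (kinf c).
  have hl := eq_card_nat (countableP _) (linf c).
  by apply: (card_eq_trans hk); rewrite card_eq_sym.
pose F x := match pselect (exists2 i, I i & ka i = x) with
  | left e => la (projT1 (cid2 e))
  | right _ => (x.1, h x.1.1 x.2) end.
have Fk i : I i -> F (ka i) = la i.
  move=> Ii; rewrite /F; case: pselect => [e|[]]; last by exists i.
  by case: cid2 => j Ij jk /=; congr la; exact: ki.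
have Fn x : ~ (ka @` I) x -> F x = (x.1, h x.1.1 x.2) by rewrite /F; case: pselect.
have diagX x : points X x -> ~ (ka @` I) x -> x.1.1 = x.1.2 by case=> // /kO.
have diagY y : points Y y -> ~ (la @` I) y -> y.1.1 = y.1.2 by case=> // /lO.
have Fn_nla x : points X x -> ~ (ka @` I) x -> ~ (la @` I) (F x).
  move=> Xx nx; rewrite Fn//; have := diagX x Xx nx.
  case: x Xx nx => -[a b] n /= Xx nx ab; subst b.
  by have /(@set_bijE _ _ _ _ _)[+ _ _] := hh a; exact.
exists F, ka; split => //.
- apply: set_bijP.
  + move=> x Xx; have [[i Ii <-]|nx] := pselect ((ka @` I) x).
      by rewrite Fk//; have [] := lY i Ii.
    by rewrite Fn//; right; rewrite /diag_copies/= diagX.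
  + move=> x y Xx Xy; have [[i Ii <-]|nx] := pselect ((ka @` I) x);
      have [[j Ij <-]|ny] := pselect ((ka @` I) y).
    * by rewrite !Fk// => /li ->.
    * by rewrite Fk// => e; exfalso; apply: (Fn_nla y) => //; exists i.
    * by rewrite (Fk j)// => e; exfalso; apply: (Fn_nla x) => //; exists j.
    * rewrite !Fn// => -[]; have := diagX x Xx nx; have := diagX y Xy ny.
      case: x Xx nx => -[a b] n /= Xx nx; case: y Xy ny => -[c d] m /= Xy ny cd ab [ac _].
      subst; have /(@set_bijE _ _ _ _ _)[_ hi _] := hh d.
      by move=> /hi -> //.
  + move=> y Yy; have [[i Ii <-]|ny] := pselect ((la @` I) y).
      by exists (ka i); [have [] := kX i Ii|exact: Fk].
    have := diagY y Yy ny; case: y Yy ny => -[a b] m /= Yy ny ab; subst b.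
    have /(@set_bijE _ _ _ _ _)[_ _ hs] := hh a; have [n nn nm] := hs m ny.
    exists ((a, a), n); first by right.
    by rewrite Fn//= nm.
- by move=> i Ii; have [? ?] := kX i Ii; rewrite Fk//; have [] := lY i Ii.
- by move=> x Xx nx; rewrite Fn//; split => //; exact: diagX.
Qed.

Lemma interpolatesE X phi t Z :
  (forall x, points X x -> (phi x).1.1 <= (phi x).1.2) -> 0 <= t <= 1 ->
  interpolates X phi t Z <-> represents (points X) (fun x => convex_comb t x.1 (phi x).1) Z.
Proof.
move=> hphi /andP[t0 t1]; split=> [[psi hp e]|[_ [psi hp e]]].
  split; last by exists psi => // x Xx ax; exact: e.
  move=> x Xx; have := points_le Xx; have := hphi x Xx; rewrite /convex_comb/=; nra.
by exists psi => // x [Xx ax]; exact: e.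
Qed.

End Families.

(** * Cost of bijections *)

Section RealSums.
Context {R : realType} {J : choiceType}.
Implicit Types (I : set J) (f h : J -> R).

Definition rsum I f : \bar R := \esum_(i in I) (f i)%:E.

Lemma rsum_ge0 I f : (forall i, 0 <= f i) -> (0 <= rsum I f)%E.
Proof. by move=> f0; apply: esum_ge0 => i _; rewrite lee_fin. Qed.

Lemma le_rsum I f h : (forall i, I i -> f i <= h i) -> (rsum I f <= rsum I h)%E.
Proof. by move=> fh; apply: le_esum => i /fh; rewrite lee_fin. Qed.

Lemma eq_rsum I f h : (forall i, I i -> f i = h i) -> rsum I f = rsum I h.
Proof. by move=> fh; apply: eq_esum => i /fh ->. Qed.

Lemma rsumD I f h : (forall i, 0 <= f i) -> (forall i, 0 <= h i) ->
  rsum I (fun i => f i + h i) = (rsum I f + rsum I h)%E.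
Proof. by move=> f0 h0; rewrite /rsum -esumD// => i _; rewrite lee_fin. Qed.

Lemma rsumZ I f c : 0 <= c -> (forall i, 0 <= f i) ->
  rsum I (fun i => c * f i) = (c%:E * rsum I f)%E.
Proof.
have le (a : R) (k : J -> R) : 0 <= a -> (forall i, 0 <= k i) ->
    (rsum I (fun i => (a * k i)%R) <= a%:E * rsum I k)%E.
  move=> a0 k0; apply: ge_ereal_sup => _ [X [finX XI] <-].
  under eq_fsbigr do rewrite EFinM.
  rewrite -ge0_mule_fsumr; last by move=> i; rewrite lee_fin.
  by rewrite lee_wpmul2l// ?lee_fin//; apply: ereal_sup_ubound; exists X.
move=> c0 f0; apply/eqP; rewrite eq_le le//=.
have [c1|c1] := eqVneq c 0.
  by rewrite c1 mul0e rsum_ge0// => i; rewrite mul0r.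
have {}c0 : 0 < c by rewrite lt0r c1.
(* The reverse inequality is [le] for the inverse factor and the scaled family. *)
have := le c^-1 (fun i => c * f i); rewrite invr_ge0 (ltW c0) => /(_ isT).
rewrite (_ : (fun i => c^-1 * (c * f i)) = f); last first.
  by apply/funext => i; rewrite mulKf ?gt_eqF.
by rewrite lee_pdivlMl//; apply => i; rewrite mulr_ge0// ltW.
Qed.

Lemma rsum_sub I I' f : (forall i, 0 <= f i) -> I `<=` I' -> (rsum I f <= rsum I' f)%E.
Proof.
move=> f0 sI; rewrite /rsum esum_mkcond [leRHS]esum_mkcond; apply: le_esum => i _.
case: ifPn => [/set_mem/sI/mem_set ->//|_]; case: ifP => // _.
by rewrite lee_fin.
Qed.

Lemma rsum_eq0 I f : (forall i, I i -> f i = 0) -> rsum I f = 0%E.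
Proof. by move=> f0; apply: esum1 => i /f0 ->. Qed.

Lemma rsum_restrict I I' f : I `<=` I' ->
  (forall i, I' i -> ~ I i -> f i = 0) -> rsum I' f = rsum I f.
Proof.
move=> sI f0; rewrite /rsum esum_mkcond [RHS]esum_mkcond; apply: eq_esum => i _.
case: ifPn => [/set_mem I'i|]; case: ifPn => //.
  by move=> /negP nI; rewrite f0// => Ii; apply: nI; rewrite inE.
by move=> /set_mem/sI/mem_set ->.
Qed.

End RealSums.

Lemma rsum_reindex {R : realType} {J J' : choiceType} (I : set J) (I' : set J')
    (e : J -> J') (f : J' -> R) :
  set_bij I I' e -> rsum I' f = rsum I (fun i => f (e i)).
Proof. by move=> h; rewrite /rsum (reindex_esum _ _ _ _ h). Qed.

(** Removes the weights: let e tend to 0 and then be tend to 1. *)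
Lemma le_of_weighted_bound {R : realType} (p c w : R) : 1 < p -> 0 <= c ->
  (forall be e : R, 0 < be -> be < 1 -> 0 < e ->
    w <= (1 - be) `^ (1 - p) * e + be `^ (1 - p) * (c + e)) -> w <= c.
Proof.
move=> p1 c0 hw; rewrite leNgt; apply/negP => cw.
have w0 : 0 < w by lra.
(* If c < w, the weight [be] below is chosen with be^(1-p) = w/m, so that be^(1-p) c stays below w
   by more than m - c; [e] is then small enough to contradict the bound. *)
pose m := (c + w) / 2; pose k := m / w.
have [m0 mw cm] : [/\ 0 < m, m < w & c < m] by split; rewrite /m; lra.
have k0 : 0 < k by rewrite divr_gt0.
have k1 : k < 1 by rewrite ltr_pdivrMr// mul1r.
pose be := k `^ (p - 1)^-1.
have pm : 0 < p - 1 by lra.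
have be0 : 0 < be by rewrite powR_gt0.
have be1 : be < 1.
  have <- : 1 `^ (p - 1)^-1 = 1 :> R by rewrite powR1.
  by apply: gt0_ltr_powR; rewrite ?nnegrE ?invr_gt0// ltW.
have beE : be `^ (1 - p) = k^-1.
  by rewrite -opprB powRN /be -powRrM mulVf ?gt_eqF// powRr1// ltW.
pose K := (1 - be) `^ (1 - p); have K0 : 0 < K by rewrite powR_gt0// subr_gt0.
have kV : 0 < k^-1 by rewrite invr_gt0.
pose e := (m - c) / 4 / (K + k^-1); have e0 : 0 < e.
  by rewrite divr_gt0// ?addr_gt0 ?divr_gt0 ?subr_gt0.
have := hw be e be0 be1 e0; rewrite beE -/K.
have eE : e * (K + k^-1) = (m - c) / 4 by rewrite divfK// gt_eqF// addr_gt0.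
have kE : k^-1 * m = w by rewrite /k invf_div divfK// gt_eqF.
have k2 : 1 < k^-1 by rewrite invf_gt1.
have : (m - c) * 1 <= (m - c) * k^-1 by rewrite ler_pM2l ?subr_gt0// ltW.
move: eE kE; lra.
Qed.

(** * The p-th power of the distance *)

Section TransportCost.
Context {R : realType} (p : R) (g : R * R -> R).
Hypotheses (p1 : 1 < p) (hg : convex_cost p g).
Implicit Types (A B C X Y Z : diagram R) (phi : dpoint R -> dpoint R).

Let p_gt0 : 0 < p. Proof. exact: lt_trans ltr01 p1. Qed.
Let g0 (v : R * R) : 0 <= g v. Proof. exact: (cost_ge0 hg). Qed.

Definition bij_cost X phi : \bar R := rsum (points X) (fun x => g (x.1 - (phi x).1)).

Definition wcost X Y : \bar R := ereal_inf [set bij_cost X phi | phi in diagram_bij X Y].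

Lemma bij_cost_ge0 X phi : (0 <= bij_cost X phi)%E.
Proof. by apply: rsum_ge0 => x. Qed.

Lemma wcost_ge0 X Y : (0 <= wcost X Y)%E.
Proof. by apply: le_ereal_inf_tmp => _ [phi _ <-]; exact: bij_cost_ge0. Qed.

Lemma wcost_le X Y phi : diagram_bij X Y phi -> (wcost X Y <= bij_cost X phi)%E.
Proof. by move=> h; apply: ereal_inf_lbound; exists phi. Qed.

Lemma wcost_approx X Y (w : \bar R) : (wcost X Y < w)%E ->
  exists2 phi, diagram_bij X Y phi & (bij_cost X phi < w)%E.
Proof. by move=> /ereal_inf_lt[_ [phi h <-]] ?; exists phi. Qed.

Lemma wcost_refl X : wcost X X = 0%E.
Proof.
apply/eqP; rewrite eq_le wcost_ge0 andbT.
have bid : diagram_bij X X id by apply: set_bijP => // x Xx; exists x.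
apply: (le_trans (wcost_le bid)); rewrite /bij_cost rsum_eq0// => x _.
by rewrite subrr (cost0 p1 hg).
Qed.

Lemma bij_cost_inverse X Y phi psi : set_bij (points Y) (points X) psi ->
  (forall y, points Y y -> phi (psi y) = y) -> bij_cost Y psi = bij_cost X phi.
Proof.
move=> bpsi pp; rewrite /bij_cost (rsum_reindex _ bpsi).
by apply: eq_rsum => y Yy; rewrite pp// (costC hg).
Qed.

Lemma wcost_sym X Y : wcost X Y = wcost Y X.
Proof.
have le A B : (wcost A B <= wcost B A)%E.
  apply: le_ereal_inf_tmp => _ [phi h <-].
  have [psi [bpsi _ e]] := set_bij_inverse ((0, 0), 0%N) h.
  by rewrite -(bij_cost_inverse bpsi); [exact: wcost_le|].
by apply/eqP; rewrite eq_le !le.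
Qed.

(** Substitute for the triangle inequality: [costD_weighted] is summed with f x as intermediate
    point. *)
Lemma rsum_weighted_comp A B f (h : dpoint R -> dpoint R) al be : diagram_bij A B f ->
  0 < al -> 0 < be -> al + be = 1 ->
  (rsum (points A) (fun x => g (x.1 - (h (f x)).1)%R) <=
   (al `^ (1 - p))%:E * bij_cost A f + (be `^ (1 - p))%:E * bij_cost B h)%E.
Proof.
move=> bf al0 be0 ab; rewrite /bij_cost (rsum_reindex _ bf) -!rsumZ ?powR_ge0//.
rewrite -rsumD; try by move=> x; rewrite mulr_ge0// powR_ge0.
apply: le_rsum => x _; rewrite -[_ - (h (f x)).1](subrKA (f x).1).
exact: (costD_weighted hg).
Qed.

Lemma wcost_lty A B C : (wcost A B < +oo)%E -> (wcost B C < +oo)%E -> (wcost A C < +oo)%E.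
Proof.
move=> /wcost_approx[f bf fy] /wcost_approx[h bh hy].
apply: le_lt_trans (wcost_le (set_bij_comp bf bh)) _.
have h2 : 0 < (2^-1 : R) by lra.
have h1 : (2^-1 + 2^-1 : R) = 1 by lra.
apply: le_lt_trans (rsum_weighted_comp _ bf h2 h2 h1) _.
by rewrite lte_add_pinfty// lte_mul_pinfty// lee_fin powR_ge0.
Qed.

(** The leg from A to B costs arbitrarily little whatever its weight, so the weight of the leg from
    B to C may approach 1. *)
Lemma wcost0_le A B C : wcost A B = 0%E -> (wcost A C <= wcost B C)%E.
Proof.
move=> AB0; have [->|BCy] := eqVneq (wcost B C) +oo%E; first by rewrite leey.
have BCf : wcost B C \is a fin_num by rewrite ge0_fin_numE ?wcost_ge0// ltey.
have ACf : wcost A C \is a fin_num.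
  by rewrite ge0_fin_numE ?wcost_ge0// (@wcost_lty A B) ?AB0// ltey.
rewrite -(fineK BCf) -(fineK ACf) lee_fin.
apply: (le_of_weighted_bound p1) => [|be e be0 be1 e0]; first by rewrite fine_ge0 ?wcost_ge0.
have al0 : 0 < 1 - be by rewrite subr_gt0.
have [f bf fe] : exists2 f, diagram_bij A B f & (bij_cost A f < e%:E)%E.
  by apply: wcost_approx; rewrite AB0 lte_fin.
have [h bh he] : exists2 h, diagram_bij B C h & (bij_cost B h < (fine (wcost B C) + e)%:E)%E.
  by apply: wcost_approx; rewrite -{1}(fineK BCf) lte_fin ltrDl.
have := le_trans (wcost_le (set_bij_comp bf bh))
  (rsum_weighted_comp _ bf al0 be0 (subrK be 1)).
rewrite -{1}(fineK ACf) -lee_fin => /le_trans; apply.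
by rewrite EFinD !EFinM; apply: leeD; apply: lee_wpmul2l; rewrite ?lee_fin ?powR_ge0// ltW.
Qed.

Lemma wcost0_eq A B C : wcost A B = 0%E -> wcost A C = wcost B C.
Proof.
move=> AB0; apply/eqP; rewrite eq_le wcost0_le//= wcost0_le//.
by rewrite wcost_sym.
Qed.

Lemma common_family_cost (J : choiceType) (I : set J) u v X Y : countable I ->
  represents I u X -> represents I v Y ->
  exists F (kappa : J -> dpoint R),
    [/\ diagram_bij X Y F,
        forall i j, I i -> I j -> kappa i = kappa j -> i = j,
        forall i, I i -> [/\ points X (kappa i), (kappa i).1 = u i & (F (kappa i)).1 = v i],
        forall x, points X x -> ~ (kappa @` I) x -> x.1.1 = x.1.2 /\ (F x).1 = x.1
      & bij_cost X F = rsum I (fun i => g (u i - v i))].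
Proof.
move=> cI rX rY; have [F [ka [bF ki kI kn]]] := common_family_bij cI rX rY.
exists F, ka; split => //.
rewrite /bij_cost (@rsum_restrict _ _ (ka @` I)).
- have bk : set_bij I (ka @` I) ka.
    by apply: set_bijP => // y [i Ii <-]; exists i.
  by rewrite (rsum_reindex _ bk); apply: eq_rsum => i /kI[_ -> ->].
- by move=> _ [i /kI[? _ _] <-].
- by move=> x Xx /(kn x Xx)[_ ->]; rewrite subrr (cost0 p1 hg).
Qed.

(** [I] may be uncountable, like [points X]: indices with both ends on the diagonal are dropped, and
    the others form a countable set. *)
Lemma wcost_le_family (J : choiceType) (I : set J) u v X Y :
  represents I u X -> represents I v Y ->
  (wcost X Y <= rsum I (fun i => g (u i - v i)%R))%E.
Proof.
move=> rX rY; pose I0 := [set i | I i /\ (above (u i) \/ above (v i))].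
have I0I : I0 `<=` I by move=> i [].
have rX0 : represents I0 u X.
  by apply: (represents_sub rX I0I) => i Ii n; apply/negP => a; apply: n; split => //; left.
have rY0 : represents I0 v Y.
  by apply: (represents_sub rY I0I) => i Ii n; apply/negP => a; apply: n; split => //; right.
have c0 : countable I0 by apply: represents_countableU rX0 rY0 _ => i [].
have [F [ka [bF _ _ _ cF]]] := common_family_cost c0 rX0 rY0.
apply: (le_trans (wcost_le bF)); rewrite cF.
by apply: rsum_sub.
Qed.

End TransportCost.

(** The p-th root is monotone with monotone inverse, so it commutes with the infimum. *)
Lemma dist_wcost {R : realType} (p : R) (q : \bar R) (X Y : diagram R) : 0 < p ->
  dist p q X Y = poweR (wcost (fun v => qnorm q v `^ p) X Y) p^-1.
Proof.
move=> p0; set g := fun v => _.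
have W0 phi : (0 <= bij_cost g X phi)%E by apply: rsum_ge0 => x; exact: powR_ge0.
have c0 phi : cost p q X phi = poweR (bij_cost g X phi) p^-1 by [].
have wc0 : (0 <= wcost g X Y)%E by apply: le_ereal_inf_tmp => _ [phi _ <-].
have pV : 0 <= p^-1 by rewrite invr_ge0 ltW.
have le_pow (r : R) (x y : \bar R) : 0 <= r -> (0 <= x)%E -> (0 <= y)%E -> (x <= y)%E ->
    (poweR x r <= poweR y r)%E.
  by move=> r0 x0 y0; apply: gt0_ler_poweR; rewrite ?in_itv/= ?andbT ?leey ?x0 ?y0.
have d0 : (0 <= dist p q X Y)%E.
  by apply: le_ereal_inf_tmp => _ [phi _ <-]; exact: poweR_ge0.
apply/eqP; rewrite eq_le; apply/andP; split; last first.
  apply: le_ereal_inf_tmp => _ [phi h <-]; rewrite c0; apply: (le_pow) => //.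
  by apply: ereal_inf_lbound; exists phi.
have powK (r s : R) (x : \bar R) : r * s = 1 -> (0 <= x)%E -> poweR (poweR x r) s = x.
  by move=> rs x0; rewrite -poweRrM rs poweRe1.
rewrite -[leLHS](@powK p p^-1) ?mulfV ?gt_eqF//; apply: (le_pow) => //.
  exact: poweR_ge0.
apply: le_ereal_inf_tmp => _ [phi h <-].
rewrite -[leRHS](@powK p^-1 p) ?mulVf ?gt_eqF// -c0.
apply: (le_pow); rewrite ?(ltW p0)//.
  by rewrite /cost poweR_ge0.
by apply: ereal_inf_lbound; exists phi.
Qed.

(** * Stability of almost optimal interpolations *)

(** The sum of [h] stays on the left until its finite lower bound [w] replaces it, so no infinite
    sum is ever subtracted. *)
Lemma rsum_le_lin {R : realType} {J : choiceType} (I : set J) (f h a b : J -> R)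
    (C P Q w al be : R) :
  (forall i, 0 <= f i) -> (forall i, 0 <= h i) -> (forall i, 0 <= a i) ->
  (forall i, 0 <= b i) -> 0 <= C -> 0 <= P -> 0 <= Q ->
  (forall i : J, I i -> f i + C * h i <= P * a i + Q * b i) ->
  (rsum I a <= al%:E)%E -> (rsum I b <= be%:E)%E -> (w%:E <= rsum I h)%E ->
  (rsum I f <= (P * al + Q * be - C * w)%:E)%E.
Proof.
move=> f0 h0 a0 b0 C0 P0 Q0 le_i le_a le_b le_h.
have le1 : (rsum I f + C%:E * rsum I h <= P%:E * rsum I a + Q%:E * rsum I b)%E.
  rewrite -!rsumZ// -!rsumD//; first exact: le_rsum;
    by move=> i; rewrite mulr_ge0.
rewrite EFinB leeBrDr//.
apply: (@le_trans _ _ (rsum I f + C%:E * rsum I h)%E).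
  by rewrite leeD2l// EFinM lee_wpmul2l// lee_fin.
apply: (le_trans le1); rewrite EFinD !EFinM.
by apply: leeD; apply: lee_wpmul2l; rewrite ?lee_fin.
Qed.

Section Stability.
Context {R : realType} (p : R) (g : R * R -> R).
Hypotheses (p1 : 1 < p) (hg : convex_cost p g).

Let g0 (v : R * R) : 0 <= g v. Proof. exact: (cost_ge0 hg). Qed.

Lemma convex_combE t (u y : R * R) : convex_comb t u y = (1 - t) *: u + t *: y.
Proof. by []. Qed.

(** The hypotheses bound the total convexity defect of the velocities on the two time intervals by
    2d. Small defect means nearly equal velocities, hence z near the convex combination; [d] does
    not depend on the family. *)
Lemma stability (w t e : R) : 0 <= w -> 0 < t -> t < 1 -> 0 < e ->
  exists2 d, 0 < d & forall (J : choiceType) (I : set J) (u z y : J -> R * R),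
    ((t `^ (1 - p))%:E * rsum I (fun i => g (u i - z i)%R) <= (t * w + d)%:E)%E ->
    (((1 - t) `^ (1 - p))%:E * rsum I (fun i => g (z i - y i)%R)
       <= ((1 - t) * w + d)%:E)%E ->
    (w%:E <= rsum I (fun i => g (u i - y i)%R))%E ->
    (rsum I (fun i => g (z i - convex_comb t (u i) (y i))%R) <= e%:E)%E.
Proof.
move=> w0 t0 t1 e0.
have s0 : 0 < 1 - t by rewrite subr_gt0.
(* The final bound is 2 eta w + (P + Q) d; [eta] and [d] make each summand at most e/2. *)
pose eta := e / (4 * (w + 1)).
have eta0 : 0 < eta by rewrite divr_gt0// mulr_gt0//; lra.
have st : t + (1 - t) = 1 by rewrite addrC subrK.
have [C C0 hC] := cost_modulus p1 hg t0 s0 st eta0.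
pose P := eta / t + C; pose Q := eta / (1 - t) + C.
have P0 : 0 <= P by rewrite addr_ge0// divr_ge0// ltW.
have Q0 : 0 <= Q by rewrite addr_ge0// divr_ge0// ltW.
pose d := e / (2 * (P + Q + 1)).
have d0 : 0 < d by rewrite divr_gt0// mulr_gt0//; lra.
exists d => // J I u z y hu hy hw.
rewrite -rsumZ ?powR_ge0// in hu; rewrite -rsumZ ?powR_ge0// in hy.
have ge0 c (v : J -> R * R) i : 0 <= c `^ (1 - p) * g (v i) by rewrite mulr_ge0// powR_ge0.
have le_i i : I i -> g (z i - convex_comb t (u i) (y i)) + C * g (u i - y i) <=
    P * (t `^ (1 - p) * g (u i - z i)) + Q * ((1 - t) `^ (1 - p) * g (z i - y i)).
  move=> _; rewrite -!(costV hg)//.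
  (* Up to sign, the velocities before and after time t; the deviation from the convex combination
     is -t(1-t)(a - b). *)
  set a := t^-1 *: (u i - z i); set b := (1 - t)^-1 *: (z i - y i).
  have ea : t *: a = u i - z i by rewrite scalerA divff ?gt_eqF// scale1r.
  have eb : (1 - t) *: b = z i - y i by rewrite scalerA divff ?gt_eqF// scale1r.
  have eab : t *: a + (1 - t) *: b = u i - y i by rewrite ea eb subrKA.
  have ec : z i - convex_comb t (u i) (y i) = (- (t * (1 - t))) *: (a - b).
    rewrite scalerBr !scaleNr mulrC -scalerA ea mulrC -scalerA eb convex_combE.
    by apply: injective_projections; rewrite /= /GRing.scale/=; ring.
  have c1 : `|- (t * (1 - t))| <= 1.
    rewrite normrN ger0_norm; last by rewrite mulr_ge0// ltW.
    by rewrite mulr_ile1 ?(ltW t0) ?(ltW t1) ?(ltW s0)// lerBlDr lerDl ltW.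
  have := hC a b; have := costZ_le p1 hg (a - b) c1.
  have h1 : eta / t * (t * g a) = eta * g a by rewrite mulrA divfK ?gt_eqF.
  have h2 : eta / (1 - t) * ((1 - t) * g b) = eta * g b by rewrite mulrA divfK ?gt_eqF.
  rewrite eab -ec /P /Q [(_ + C) * (t * _)]mulrDl [(_ + C) * _]mulrDl h1 h2; lra.
apply: le_trans (rsum_le_lin _ _ (ge0 _ _) (ge0 _ _) C0 P0 Q0 le_i hu hy hw) _ => //.
rewrite lee_fin.
have -> : P * (t * w + d) + Q * ((1 - t) * w + d) - C * w = 2 * eta * w + (P + Q) * d.
  by rewrite /P /Q; field; rewrite !gt_eqF.
have h1 : eta * (4 * (w + 1)) = e by rewrite divfK// gt_eqF// mulr_gt0//; lra.
have h2 : d * (2 * (P + Q + 1)) = e by rewrite divfK// gt_eqF// mulr_gt0//; lra.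
by move: eta0 d0 h1 h2; lra.
Qed.

End Stability.

(** * Almost optimal bijections along a geodesic *)

Section Chain.
Context {R : realType} (p : R) (g : R * R -> R) (w : R) (mu : R -> diagram R).
Hypotheses (p1 : 1 < p) (hg : convex_cost p g) (w0 : 0 <= w).
Hypothesis hmu : forall s t : R, 0 <= s -> s < t -> t <= 1 ->
  wcost g (mu s) (mu t) = ((t - s) `^ p * w)%:E.

Let g0 (v : R * R) : 0 <= g v. Proof. exact: (cost_ge0 hg). Qed.

(** The factor (t - s)^(1-p) turns the cost into an action that is linear in elapsed time along the
    geodesic. *)
Lemma segment_approx (s t d : R) : 0 <= s -> s < t -> t <= 1 -> 0 < d ->
  exists2 f, diagram_bij (mu s) (mu t) f &
    (((t - s) `^ (1 - p))%:E * bij_cost g (mu s) f <= ((t - s) * w + d)%:E)%E.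
Proof.
move=> s0 st t1 d0; have ts : 0 < t - s by rewrite subr_gt0.
have k0 : 0 < (t - s) `^ (1 - p) by rewrite powR_gt0.
pose k := (t - s) `^ (1 - p); have e0 : 0 < d / k by rewrite divr_gt0.
have [f bf fe] : exists2 f, diagram_bij (mu s) (mu t) f &
    (bij_cost g (mu s) f < ((t - s) `^ p * w + d / k)%:E)%E.
  by apply: wcost_approx; rewrite hmu// lte_fin ltrDl.
exists f => //; apply: (@le_trans _ _ (k%:E * ((t - s) `^ p * w + d / k)%:E)%E).
  by rewrite lee_wpmul2l ?lee_fin ?ltW.
rewrite -EFinM lee_fin mulrDr mulrA (mulrC k (d / k)) divfK ?gt_eqF//.
suff -> : k * (t - s) `^ p = t - s by [].
rewrite /k -powRD; last by rewrite (gt_eqF ts) implybT.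
by rewrite subrK powRr1// ltW.
Qed.

(** Actions add under composition: the weights are the fractions of the total duration. *)
Lemma action_comp A B f (h : dpoint R -> dpoint R) (a b ca cb : R) :
  diagram_bij A B f -> 0 < a -> 0 < b ->
  ((a `^ (1 - p))%:E * bij_cost g A f <= ca%:E)%E ->
  ((b `^ (1 - p))%:E * bij_cost g B h <= cb%:E)%E ->
  (((a + b) `^ (1 - p))%:E * rsum (points A) (fun x => g (x.1 - (h (f x)).1)%R)
    <= (ca + cb)%:E)%E.
Proof.
move=> bf a0 b0 ha hb; have ab0 : 0 < a + b by rewrite addr_gt0.
have al0 : 0 < a / (a + b) by rewrite divr_gt0.
have be0 : 0 < b / (a + b) by rewrite divr_gt0.
have e : a / (a + b) + b / (a + b) = 1 by rewrite -mulrDl divff// gt_eqF.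
have hk c : 0 < c -> (a + b) `^ (1 - p) * (c / (a + b)) `^ (1 - p) = c `^ (1 - p).
  move=> c0; rewrite -powRM ?ltW//; last by rewrite divr_gt0.
  by rewrite mulrC divfK// gt_eqF.
have k0 : 0 <= (a + b) `^ (1 - p) by rewrite powR_ge0.
have := rsum_weighted_comp hg h bf al0 be0 e.
move=> /(lee_wpmul2l (x := ((a + b) `^ (1 - p))%:E)); rewrite lee_fin => /(_ k0) h1.
have pos (c : R) X k : (0 <= (c `^ (1 - p))%:E * bij_cost g X k)%E.
  by rewrite mule_ge0 ?lee_fin ?powR_ge0// (bij_cost_ge0 hg).
apply: (le_trans h1); rewrite ge0_muleDr//.
by rewrite !muleA -!EFinM !hk// EFinD leeD.
Qed.

(** Induction on the times: each step spends half of the tolerance on the first segment and leaves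
    the other half to the rest. *)
Lemma chain_approx (T : seq R) (s d : R) : 0 <= s -> s < 1 -> path <%R s T ->
  all (fun t => t < 1) T -> 0 < d ->
  exists phi, [/\ diagram_bij (mu s) (mu 1) phi,
    (((1 - s) `^ (1 - p))%:E * bij_cost g (mu s) phi <= ((1 - s) * w + d)%:E)%E
  & forall t, t \in T -> exists z, [/\ diagram_bij (mu s) (mu t) z,
      (((t - s) `^ (1 - p))%:E * bij_cost g (mu s) z <= ((t - s) * w + d)%:E)%E
    & (((1 - t) `^ (1 - p))%:E *
        rsum (points (mu s)) (fun x => g ((z x).1 - (phi x).1)%R)
        <= ((1 - t) * w + d)%:E)%E]].
Proof.
elim: T s d => [|t T IH] s d s0 s1 /=.
  by move=> _ _ d0; have [f bf fe] := segment_approx s0 s1 (lexx 1) d0; exists f; split.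
move=> /andP[st pT] /andP[t1 T1] d0.
have d2 : 0 < d / 2 by rewrite divr_gt0.
have t0 : 0 <= t by rewrite (le_trans s0) ?ltW.
have [f bf fe] := segment_approx s0 st (ltW t1) d2.
have [phi [bphi cphi hz]] := IH t (d / 2) t0 t1 pT T1 d2.
have ts0 : 0 < t - s by rewrite subr_gt0.
have tail (h : dpoint R -> dpoint R) (r : R) : t < r ->
    (((r - t) `^ (1 - p))%:E * bij_cost g (mu t) h <= ((r - t) * w + d / 2)%:E)%E ->
    (((r - s) `^ (1 - p))%:E * bij_cost g (mu s) (h \o f) <= ((r - s) * w + d)%:E)%E.
  move=> tr hr; have rt0 : 0 < r - t by rewrite subr_gt0.
  have := action_comp bf ts0 rt0 fe hr.
  have -> : t - s + (r - t) = r - s by rewrite addrC subrKA.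
  by have -> : (t - s) * w + d / 2 + ((r - t) * w + d / 2) = (r - s) * w + d by field.
exists (phi \o f); split; [exact: set_bij_comp bf bphi|exact: tail|].
move=> r; rewrite inE => /orP[/eqP ->|rT].
  exists f; split => //; first by apply: le_trans fe _; rewrite lee_fin; lra.
  rewrite -(rsum_reindex (fun x => g (x.1 - (phi x).1)) bf).
  by apply: le_trans cphi _; rewrite lee_fin; lra.
have [z [bz cz czp]] := hz r rT.
have tr : t < r by move: pT; rewrite lt_path_sortedE => /andP[/allP/(_ r rT)].
exists (z \o f); split; [exact: set_bij_comp bf bz|exact: tail|].
rewrite -(rsum_reindex (fun x => g ((z x).1 - (phi x).1)) bf).
by apply: le_trans czp _; rewrite lee_fin; lra.
Qed.

Lemma bijection_approx (T : seq R) (d : R) : (forall t, t \in T -> 0 < t < 1) -> 0 < d ->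
  exists phi, [/\ diagram_bij (mu 0) (mu 1) phi,
    (bij_cost g (mu 0) phi <= (w + d)%:E)%E
  & forall t, t \in T -> exists2 z, diagram_bij (mu 0) (mu t) z &
      (rsum (points (mu 0)) (fun x => g ((z x).1 - convex_comb t x.1 (phi x).1)%R)
        <= d%:E)%E].
Proof.
move=> hT d0.
(* One tolerance for all the times in [T]: the minimum of those given by [stability]. *)
have [d' d'0 [d'd hd']] : exists2 d', 0 < d' & d' <= d /\ forall t, t \in T ->
    forall (I : set (dpoint R)) (u z y : dpoint R -> R * R),
    ((t `^ (1 - p))%:E * rsum I (fun i => g (u i - z i)%R) <= (t * w + d')%:E)%E ->
    (((1 - t) `^ (1 - p))%:E * rsum I (fun i => g (z i - y i)%R)
       <= ((1 - t) * w + d')%:E)%E ->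
    (w%:E <= rsum I (fun i => g (u i - y i)%R))%E ->
    (rsum I (fun i => g (z i - convex_comb t (u i) (y i))%R) <= d%:E)%E.
  elim: T hT => [|t T IH] hT; first by exists d.
  have [|d1 d10 [d1d h1]] := IH; first by move=> r rT; apply: hT; rewrite inE rT orbT.
  have /andP[t0 t1] : 0 < t < 1 by apply: hT; rewrite inE eqxx.
  have [d2 d20 h2] := stability p1 hg w0 t0 t1 d0.
  exists (Num.min d1 d2); first by rewrite lt_min d10.
  split; first by rewrite ge_min d1d.
  move=> r; rewrite inE => /orP[/eqP ->|rT] I u z y hu hy.
    apply: h2; [apply: le_trans hu _|apply: le_trans hy _];
      by rewrite lee_fin lerD2l ge_min lexx orbT.
  apply: (h1 r rT); [apply: le_trans hu _|apply: le_trans hy _];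
    by rewrite lee_fin lerD2l ge_min lexx.
(* The chain needs strictly increasing times. *)
pose T' := sort <=%R (undup T).
have T'E t : (t \in T') = (t \in T) by rewrite mem_sort mem_undup.
have pT' : path <%R 0 T'.
  rewrite lt_path_sortedE; apply/andP; split.
    by apply/allP => t; rewrite T'E => /hT/andP[].
  by rewrite lt_sorted_uniq_le sort_uniq undup_uniq sort_le_sorted.
have T1 : all (fun t => t < 1) T' by apply/allP => t; rewrite T'E => /hT/andP[].
have [phi [bphi cphi hz]] := chain_approx (lexx 0) ltr01 pT' T1 d'0.
rewrite !subr0 powR1 mul1e mul1r in cphi.
exists phi; split => //; first by apply: le_trans cphi _; rewrite lee_fin lerD2l.
move=> t tT; have [|z [bz]] := hz t; first by rewrite T'E.
rewrite !subr0 => cz czp; exists z => //; apply: (hd' t tT) => //.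
by have := wcost_le g bphi; rewrite hmu// subr0 powR1 mul1r.
Qed.

End Chain.

(** * Families induced by partial matchings *)

Section MatchingFamily.
Context {R : realType} (X Y : diagram R).
Implicit Types (phi : dpoint R -> dpoint R) (m : dpoint R -> option (dpoint R)).

(** Only pairs of off-diagonal points are recorded, so diagrams with finitely many such points admit
    finitely many matchings. *)
Definition matching phi (x : dpoint R) : option (dpoint R) :=
  if `[< offdiag X x /\ offdiag Y (phi x) >] then Some (phi x) else None.

(* A partial matching [m], extended by sending unmatched points to their nearest
   points on the diagonal, as a family indexed by the points of [X] and the
   unmatched points of [Y]. *)
Definition match_index m : set (dpoint R + dpoint R) :=
  [set j | match j with
           | inl x => offdiag X x
           | inr y => offdiag Y y /\ ~ (exists x, m x = Some y) end].

Definition match_src (j : dpoint R + dpoint R) : R * R :=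
  match j with inl x => x.1 | inr y => diag_proj y.1 end.

Definition match_dst m (j : dpoint R + dpoint R) : R * R :=
  match j with
  | inl x => if m x is Some y then y.1 else diag_proj x.1
  | inr y => y.1 end.

Lemma matchingP phi x y : matching phi x = Some y <->
  [/\ offdiag X x, offdiag Y y & phi x = y].
Proof.
rewrite /matching; case: asboolP => [[Xx Yx]|n].
  by split=> [[<-]|[_ _ ->]].
by split=> // -[Xx Yy e]; exfalso; apply: n; rewrite e.
Qed.

Lemma matching_none phi x : offdiag X x -> matching phi x = None -> ~ offdiag Y (phi x).
Proof. by rewrite /matching; case: asboolP => // n Xx _ Yx; apply: n. Qed.

Section Bijection.
Variable phi : dpoint R -> dpoint R.
Hypothesis bphi : diagram_bij X Y phi.
Notation m := (matching phi).
Notation I := (match_index m).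

Let phi_fun x : points X x -> points Y (phi x).
Proof. have [h _ _] := set_bijE bphi; exact: h. Qed.
Let phi_inj x y : points X x -> points X y -> phi x = phi y -> x = y.
Proof. have [_ h _] := set_bijE bphi; exact: h. Qed.
Let phi_surj y : points Y y -> exists2 x, points X x & phi x = y.
Proof. have [_ _ h] := set_bijE bphi; exact: h. Qed.

Lemma match_src_represents : represents I match_src X.
Proof.
split.
  move=> [x|y] /= Ij; last by [].
  by apply: (@points_le _ X); left.
exists (fun j => match j with inl x => x | inr y => y end); last first.
  by move=> [x|y] // _; rewrite /above/= ltxx.
apply: set_bijP.
- by move=> [x|y] /= [] //; rewrite /above/= ltxx.
- move=> [x|y] [x'|y'] /= [] Ij; rewrite /above/= ?ltxx// => _ [] Ij' //; rewrite ?ltxx//.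
  by move=> _ ->.
- by move=> x Xx; exists (inl x) => //; split => //; have /offdiag_points[] := Xx.
Qed.

Lemma match_dst_represents : represents I (match_dst m) Y.
Proof.
have Yle y : offdiag Y y -> y.1.1 <= y.1.2 by move=> Yy; apply: (@points_le _ Y); left.
split.
  move=> [x|y] /=; last by case=> /Yle.
  by case e : (m x) => [y|]; rewrite //= => _; move/matchingP : e => [_ /Yle].
have inlP x : offdiag X x -> above (match_dst m (inl x)) -> m x = Some (phi x).
  move=> Xx /=; case e : (m x) => [y|]; last by rewrite /above/= ltxx.
  by have /matchingP[_ _ ->] := e.
exists (fun j => match j with inl x => phi x | inr y => y end); last first.
  by move=> [x|y] //= Xx; case e : (m x) => [y|]; rewrite /above/= ?ltxx//;
    move/matchingP : e => [_ _ ->].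
apply: set_bijP.
- move=> [x|y] [/= Ij aj]; last by case: Ij.
  by have /matchingP[] := inlP x Ij aj.
- move=> [x|y] [x'|y'] /= [Ij aj] [Ij' aj'].
  + by move=> /phi_inj -> //; left.
  + by move=> e; exfalso; case: Ij' => _; apply; exists x; rewrite (inlP x Ij aj) e.
  + by move=> e; exfalso; case: Ij => _; apply; exists x'; rewrite (inlP x' Ij' aj') e.
  + by move=> ->.
- move=> y Yy; have [[x mx]|nm] := pselect (exists x, m x = Some y).
    have /matchingP[Xx _ e] := mx; exists (inl x) => //; split => //=.
    by rewrite mx; have /offdiag_points[] := Yy.
  by exists (inr y) => //; split => //=; have /offdiag_points[] := Yy.
Qed.

Lemma match_above j : I j -> above (match_src j) \/ above (match_dst m j).
Proof.
case: j => [x|y] /=; first by move=> /offdiag_points[]; left.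
by case=> /offdiag_points[]; right.
Qed.

Lemma match_countable : countable I.
Proof. exact: represents_countableU match_src_represents match_dst_represents match_above. Qed.

(** The points that correspond to the indices of the matching family; all others are moved within
    the diagonal. *)
Definition essential : set (dpoint R) :=
  [set x | points X x /\ (offdiag X x \/ offdiag Y (phi x))].

Definition essential_index (x : dpoint R) : dpoint R + dpoint R :=
  if `[< offdiag X x >] then inl x else inr (phi x).

Lemma essential_index_bij : set_bij essential I essential_index.
Proof.
apply: set_bijP.
- move=> x [Xx]; rewrite /essential_index; case: asboolP => // nX [//|Yx] /=.
  split=> // -[x' /matchingP[Xx' _ e]]; apply: nX.
  by rewrite -(phi_inj _ Xx e)//; left.
- move=> x y [Xx _] [Xy _]; rewrite /essential_index.
  by case: asboolP => _; case: asboolP => _ // [] //; exact: phi_inj.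
- move=> [x|y] /=.
    move=> Xx; exists x; first by split; left.
    by rewrite /essential_index; case: asboolP.
  move=> [Yy nm]; have [x Xx e] := phi_surj (or_introl Yy).
  exists x; first by split => //; right; rewrite e.
  rewrite /essential_index; case: asboolP => [Ox|_]; last by rewrite e.
  by exfalso; apply: nm; exists x; apply/matchingP.
Qed.

Lemma inessential x : points X x -> ~ essential x -> x.1.1 = x.1.2 /\ (phi x).1.1 = (phi x).1.2.
Proof.
move=> Xx ne; have nX : ~ offdiag X x by move=> Ox; apply: ne; split => //; left.
have nY : ~ offdiag Y (phi x) by move=> Ox; apply: ne; split => //; right.
by split; [case: Xx|case: (phi_fun Xx)].
Qed.

End Bijection.

(** If every matching failed at some index, a bijection good at these finitely many indices would
    have no matching left. *)
Lemma matching_pigeonhole (S : eqType) (P : S -> (dpoint R -> dpoint R) -> Prop) :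
  finite_set (offdiag X) -> finite_set (offdiag Y) ->
  (forall s : seq S, exists phi, forall i, i \in s -> P i phi) ->
  exists m, forall i, exists2 phi, matching phi = m & P i phi.
Proof.
move=> /finite_seqP[sX eX] /finite_seqP[sY eY] hP.
pose code phi : {ffun seq_sub sX -> option (seq_sub sY)} :=
  [ffun x => obind insub (matching phi (val x))].
have code_inj phi phi' : code phi = code phi' -> matching phi = matching phi'.
  move=> /ffunP e; apply/funext => x.
  have [xX|xX] := boolP (x \in sX); last first.
    have n psi : matching psi x = None.
      by rewrite /matching; case: asboolP => // -[]; rewrite eX /= (negbTE xX).
    by rewrite !n.
  have := e (SeqSub xX); rewrite !ffunE /=.
  have inY psi y : matching psi x = Some y -> y \in sY.
    by move=> /matchingP[_]; rewrite eY.
  case e1 : (matching phi x) => [y|]; case e2 : (matching phi' x) => [y'|] //=.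
  - by rewrite !insubT ?(inY _ _ e1) ?(inY _ _ e2)// => h1 h2 [->].
  - by rewrite insubT ?(inY _ _ e1).
  - by rewrite insubT ?(inY _ _ e2).
have [c hc] : exists c, forall i, exists2 phi, code phi = c & P i phi.
  apply: contrapT => /forallNP nc.
  have /choice[bad hbad] : forall c, exists i, forall phi, code phi = c -> ~ P i phi.
    by move=> c; have /existsNP[i hi] := nc c; exists i => phi e h; apply: hi; exists phi.
  have [phi hphi] := hP (map bad (enum {ffun seq_sub sX -> option (seq_sub sY)})).
  by apply: (hbad (code phi) phi erefl); apply: hphi; rewrite map_f// mem_enum.
(* An index is needed to realise the code [c] by an actual map; for empty [S] any value of m will
   do. *)
have [[i0 _]|nS] := pselect (exists i : S, True).
  have [phi0 e0 _] := hc i0; exists (matching phi0) => i.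
  by have [phi e h] := hc i; exists phi => //; apply: code_inj; rewrite e.
by exists (fun=> None) => i; exfalso; apply: nS; exists i.
Qed.

End MatchingFamily.

(** * Replacing a bijection by its matching family *)

Section MatchingEstimates.
Context {R : realType} (p : R) (g : R * R -> R).
Hypotheses (p1 : 1 < p) (hg : convex_cost p g).
Variables (X Y : diagram R) (phi : dpoint R -> dpoint R).
Hypothesis bphi : diagram_bij X Y phi.
Notation m := (matching X Y phi).
Notation I := (match_index X Y m).
Notation src x := (match_src (essential_index X phi x)).
Notation dst x := (match_dst m (essential_index X phi x)).

Let g0 (v : R * R) : 0 <= g v. Proof. exact: (cost_ge0 hg). Qed.

(** At most one end changes, namely one on the diagonal, which moves to the projection of the other
    end; [diag_modulus] bounds this move. *)
Lemma essential_error (eta C : R) x : 0 <= eta -> 0 <= C ->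
  diag_modulus g eta C ->
  essential X Y phi x ->
  g (src x - dst x) <= g (x.1 - (phi x).1) /\
  g (x.1 - src x) + g ((phi x).1 - dst x) + C * g (src x - dst x)
    <= (eta + C) * g (x.1 - (phi x).1).
Proof.
move=> eta0 C0 hC [Xx ess]; rewrite /essential_index; case: asboolP => [Ox|nOx] /=.
  rewrite subrr (cost0 p1 hg) add0r; case e : (m x) => [y|].
    have /matchingP[_ _ ->] := e; rewrite subrr (cost0 p1 hg) add0r mulrDl lerDr.
    by split => //; rewrite mulr_ge0.
  have nY := matching_none Ox e.
  have [_ [//|dphi]] : true /\ points Y (phi x) by have [h _ _] := set_bijE bphi; split=> //; exact: h.
  by have := hC x.1 _ dphi; rewrite [g ((phi x).1 - _)](costC hg); lra.
case: ess => // Oy; have dx : x.1.1 = x.1.2 by case: Xx.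
have := hC (phi x).1 _ dx; rewrite subrr (cost0 p1 hg) addr0.
by rewrite ![g (_ - (phi x).1)](costC hg) [g (x.1 - diag_proj _)](costC hg); lra.
Qed.

Lemma rsum_match_index (f : R * R -> R * R -> R) :
  rsum I (fun j => f (match_src j) (match_dst m j)) =
  rsum (essential X Y phi) (fun x => f (src x) (dst x)).
Proof. exact: rsum_reindex (essential_index_bij bphi). Qed.

Lemma match_cost_le : (rsum I (fun j => g (match_src j - match_dst m j)%R) <= bij_cost g X phi)%E.
Proof.
rewrite (rsum_match_index (fun u v => g (u - v))).
have [C C0 hC] := cost_diag_modulus p1 hg ltr01.
apply: (@le_trans _ _ (rsum (essential X Y phi) (fun x => g (x.1 - (phi x).1)))).
  by apply: le_rsum => x ex; have [] := essential_error ler01 C0 hC ex.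
by apply: rsum_sub => // x [].
Qed.

Lemma match_cost_ge : (wcost g X Y <= rsum I (fun j => g (match_src j - match_dst m j)%R))%E.
Proof.
apply: (wcost_le_family p1 hg); [exact: match_src_represents|exact: match_dst_represents].
Qed.

(** The matching family still costs at least w while phi costs at most w + d, so of the terms with
    factor C only C d survives. *)
Lemma match_error (eta C w d : R) : 0 <= eta -> 0 <= C ->
  diag_modulus g eta C ->
  (w%:E <= wcost g X Y)%E -> (bij_cost g X phi <= (w + d)%:E)%E ->
  (rsum (essential X Y phi) (fun x => (g (x.1 - src x) + g ((phi x).1 - dst x))%R)
   <= (eta * w + (eta + C) * d)%:E)%E.
Proof.
move=> eta0 C0 hC hw hd.
have sub : (rsum (essential X Y phi) (fun x => g (x.1 - (phi x).1)%R) <= (w + d)%:E)%E.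
  by apply: le_trans hd; apply: rsum_sub => // x [].
have hw' := le_trans hw match_cost_ge.
rewrite (rsum_match_index (fun u v => g (u - v))) in hw'.
have z0 : (rsum (essential X Y phi) (fun=> 0%R : R) <= (0 : R)%:E)%E by rewrite rsum_eq0.
rewrite (_ : eta * w + _ = (eta + C) * (w + d) + 0 * 0 - C * w); last by ring.
apply: (rsum_le_lin _ _ _ _ C0 (addr_ge0 eta0 C0) (lexx 0) _ sub z0 hw') => // x.
  by rewrite addr_ge0.
by move=> /(essential_error eta0 C0 hC)[_]; rewrite mul0r addr0.
Qed.

Lemma match_interpolation_error (t : R) (Z M : diagram R) (z : dpoint R -> dpoint R)
    (eta C w d : R) : 0 < t -> t < 1 -> 0 <= eta -> 0 <= C ->
  diag_modulus g eta C ->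
  (w%:E <= wcost g X Y)%E -> (bij_cost g X phi <= (w + d)%:E)%E ->
  represents I (fun j => convex_comb t (match_src j) (match_dst m j)) Z ->
  diagram_bij X M z ->
  (rsum (points X) (fun x => g ((z x).1 - convex_comb t x.1 (phi x).1)%R) <= d%:E)%E ->
  (wcost g Z M <= (2^-1 `^ (1 - p) * (eta * w + (eta + C + 1) * d))%:E)%E.
Proof.
move=> t0 t1 eta0 C0 hC hw hd rZ bz hz.
pose comb x := convex_comb t x.1 (phi x).1.
(* The family of [Z] is moved to the index set [points X]; at inessential points both ends are
   diagonal, so [comb] may be kept there. *)
pose wt x := if `[< essential X Y phi x >] then convex_comb t (src x) (dst x) else comb x.
have rZ' : represents (points X) wt Z.
  apply: (represents_reindex rZ (essential_index_bij bphi)).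
  - by move=> x [].
  - by move=> x ex; rewrite /wt; case: asboolP.
  - move=> x Xx nx; rewrite /wt; case: asboolP => // _.
    by have [h1 h2] := inessential bphi Xx nx; rewrite /comb /convex_comb/= h1 h2.
apply: (le_trans (wcost_le_family p1 hg rZ' (represents_points bz))).
pose err x := if `[< essential X Y phi x >]
  then g (x.1 - src x) + g ((phi x).1 - dst x) else 0.
have err0 x : 0 <= err x by rewrite /err; case: asboolP => // _; rewrite addr_ge0.
have werr x : g (wt x - comb x) <= err x.
  rewrite /wt /err; case: asboolP => _; last by rewrite subrr (cost0 p1 hg).
  rewrite (costC hg) /comb !convex_combE.
  rewrite (_ : _ - _ = (1 - t) *: (x.1 - src x) + t *: ((phi x).1 - dst x)); last first.
    by rewrite !scalerBr opprD addrACA.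
  have s0 : 0 < 1 - t by rewrite subr_gt0.
  have [h _] := cost_convex hg (x.1 - src x) ((phi x).1 - dst x) s0 t0 (subrK t 1).
  apply: (le_trans h); apply: lerD.
    by rewrite ler_piMl// lerBlDr lerDl ltW.
  by rewrite ler_piMl// ltW.
pose K : R := 2^-1 `^ (1 - p).
have K0 : 0 <= K by rewrite powR_ge0.
have h2 : 0 < (2^-1 : R) by lra.
have h21 : (2^-1 + 2^-1 : R) = 1 by lra.
(* Two-step estimate through [comb] with equal weights 1/2, which is where [K] comes from. *)
have le_x x : g (wt x - (z x).1) <= K * (err x + g ((z x).1 - comb x)).
  rewrite -(subrKA (comb x)); apply: (le_trans (costD_weighted hg _ _ h2 h2 h21)).
  by rewrite -/K -mulrDr ler_wpM2l// [g (comb x - _)](costC hg) lerD.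
apply: (@le_trans _ _ (rsum (points X) (fun x => K * (err x + g ((z x).1 - comb x))))).
  by apply: le_rsum.
rewrite rsumZ//; last by move=> x; rewrite addr_ge0.
rewrite EFinM lee_wpmul2l ?lee_fin// rsumD//.
rewrite (_ : eta * w + _ = (eta * w + (eta + C) * d) + d); last by ring.
rewrite EFinD leeD//.
rewrite (@rsum_restrict _ _ (essential X Y phi)); first last.
- by move=> x _ nx; rewrite /err; case: asboolP.
- by move=> x [].
rewrite (eq_rsum (h := fun x => g (x.1 - src x) + g ((phi x).1 - dst x))).
  exact: match_error.
by move=> x ex; rewrite /err; case: asboolP.
Qed.

End MatchingEstimates.

(** * The limit matching *)

Lemma exists_common_bound {R : realType} (T : eqType) (f : T -> R) (s : seq T) :
  exists2 d, 0 < d & forall i, i \in s -> 0 < f i -> d <= f i.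
Proof.
elim: s => [|i s [d d0 hd]]; first by exists 1.
have [fi|fi] := ltP 0 (f i); last first.
  exists d => // j; rewrite inE => /orP[/eqP ->|/hd//].
  by rewrite ltNge fi.
exists (Num.min d (f i)); first by rewrite lt_min d0.
move=> j; rewrite inE => /orP[/eqP -> _|js fj]; first by rewrite ge_min lexx orbT.
by rewrite ge_min hd.
Qed.

Section Main.
Context {R : realType} (p : R) (g : R * R -> R) (w : R) (mu : R -> diagram R).
Hypotheses (p1 : 1 < p) (hg : convex_cost p g) (w0 : 0 <= w).
Hypothesis hmu : forall s t : R, 0 <= s -> s < t -> t <= 1 ->
  wcost g (mu s) (mu t) = ((t - s) `^ p * w)%:E.
Hypotheses (finX : finite_set (offdiag (mu 0))) (finY : finite_set (offdiag (mu 1))).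
Notation X := (mu 0).
Notation Y := (mu 1).

Let wXY : wcost g X Y = w%:E.
Proof. by rewrite hmu// subr0 powR1 mul1r. Qed.

(** The pigeonhole runs over pairs (t, d): finitely many pairs are served at once by a common
    positive lower bound of their positive tolerances. *)
Lemma limit_matching : exists m, forall t d : R, exists2 phi, matching X Y phi = m &
  [/\ diagram_bij X Y phi, 0 < d -> (bij_cost g X phi <= (w + d)%:E)%E
    & 0 < t < 1 -> 0 < d -> exists2 z, diagram_bij X (mu t) z &
      (rsum (points X) (fun x => g ((z x).1 - convex_comb t x.1 (phi x).1)%R) <= d%:E)%E].
Proof.
have [|m hm] := matching_pigeonhole (S := (R * R)%type) (P := fun i phi =>
  [/\ diagram_bij X Y phi, 0 < i.2 -> (bij_cost g X phi <= (w + i.2)%:E)%E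
    & 0 < i.1 < 1 -> 0 < i.2 -> exists2 z, diagram_bij X (mu i.1) z &
      (rsum (points X) (fun x => g ((z x).1 - convex_comb i.1 x.1 (phi x).1)%R)
       <= i.2%:E)%E]) finX finY; last by exists m => t d; exact: hm (t, d).
move=> s; have [d d0 hd] := exists_common_bound (fun i : R * R => i.2) s.
pose T := [seq i.1 | i <- s & 0 < i.1 < 1].
have hT t : t \in T -> 0 < t < 1 by case/mapP => i; rewrite mem_filter => /andP[? _] ->.
have [phi [bphi cphi hz]] := bijection_approx p1 hg w0 hmu hT d0.
exists phi => i si; split=> // [i0|i01 i0].
  by apply: (le_trans cphi); rewrite lee_fin lerD2l hd.
have [|z bz cz] := hz i.1; first by apply: map_f; rewrite mem_filter i01.
by exists z => //; apply: (le_trans cz); rewrite lee_fin hd.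
Qed.

Lemma limit_bijection : exists phi (Z : R -> diagram R),
  [/\ diagram_bij X Y phi, bij_cost g X phi = w%:E,
      forall t, 0 < t < 1 -> interpolates X phi t (Z t)
    & forall t, 0 < t < 1 -> wcost g (Z t) (mu t) = 0%E].
Proof.
have [m hm] := limit_matching.
(* Any parameters will do here: some bijection inducing [m] is enough to see that its family
   represents both diagrams. *)
have [phi0 m0 [b0 _ _]] := hm 0 0.
have rX := match_src_represents X Y phi0; have rY := match_dst_represents b0.
have cI := match_countable b0; rewrite m0 in rX rY cI.
have [F [ka [bF ki kI kn cF]]] := common_family_cost p1 hg cI rX rY.
have combI t j : 0 < t < 1 -> match_index X Y m j ->
    (convex_comb t (match_src j) (match_dst m j)).1
    <= (convex_comb t (match_src j) (match_dst m j)).2.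
  move=> /andP[t0 t1] Ij; apply: lerD.
    by rewrite ler_pM2l ?subr_gt0//; exact: rX.1.
  by rewrite ler_pM2l//; exact: rY.1.
have /choice[Z hZ] : forall t, exists Z, 0 < t < 1 ->
    represents (match_index X Y m) (fun j => convex_comb t (match_src j) (match_dst m j)) Z.
  move=> t; have [t01|nt] := pselect (0 < t < 1); last by exists X.
  by have [Z hZ] := represents_exists cI (fun j => combI t j t01); exists Z.
exists F, Z; split => //.
(* The cost of [F] depends on [m] alone, hence is at most w + d for every positive d. *)
- apply/eqP; rewrite eq_le -{2}wXY wcost_le// andbT.
  apply/lee_addgt0Pr => d d0; have [phi e [bphi cphi _]] := hm 0 d.
  by rewrite -EFinD; apply: le_trans (cphi d0); rewrite cF -e; exact: (match_cost_le p1 hg bphi).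
- move=> t t01; have /andP[t0 t1] := t01.
  apply/interpolatesE; last first.
  + have bk : set_bij (match_index X Y m) (ka @` match_index X Y m) ka.
      by apply: set_bijP => // y [j Ij <-]; exists j.
    have [th [bth tk kt]] := set_bij_inverse (inl point) bk.
    apply: (represents_reindex (hZ t t01) bth).
    * by move=> _ [j /kI[? _ _] <-].
    * by move=> _ [j Ij <-]; rewrite tk//; have [_ -> ->] := kI j Ij.
    * by move=> x Xx /(kn x Xx)[xd ->]; rewrite /convex_comb/= xd.
  + by rewrite !ltW.
  + move=> x Xx; apply: (@points_le _ Y); have [h _ _] := set_bijE bF; exact: h.
- move=> t t01; have /andP[t0 t1] := t01.
  apply/eqP; rewrite eq_le (wcost_ge0 hg) andbT.
  apply/lee_addgt0Pr => e e0; rewrite add0e.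
  pose K : R := 2^-1 `^ (1 - p).
  have K0 : 0 < K by rewrite powR_gt0.
  (* The error will be K (eta w + L d); [eta] makes its first part at most e/2, and [d], chosen
     after [C], makes the second equal to e/2. *)
  pose eta := e / (2 * K * (w + 1)).
  have w10 : 0 < w + 1 by rewrite ltr_wpDl.
  have eta0 : 0 < eta by rewrite divr_gt0// !mulr_gt0.
  have [C C0 hC] := cost_diag_modulus p1 hg eta0.
  pose L := eta + C + 1; have L0 : 0 < L by rewrite /L; lra.
  pose d := e / (2 * K * L); have d0 : 0 < d by rewrite divr_gt0// !mulr_gt0.
  have [phi em [bphi cphi hz]] := hm t d; have [z bz cz] := hz t01 d0.
  have rZ := hZ t t01; rewrite -em in rZ.
  have := match_interpolation_error p1 hg bphi t0 t1 (ltW eta0) C0 hC _ (cphi d0) rZ bz cz.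
  rewrite wXY lexx => /(_ isT) h; apply: (le_trans h); rewrite lee_fin -/K -/L.
  have h1 : eta * (2 * K * (w + 1)) = e by rewrite divfK// gt_eqF// !mulr_gt0.
  have h2 : d * (2 * K * L) = e by rewrite divfK// gt_eqF// !mulr_gt0.
  have h3 : 0 <= K * eta by rewrite mulr_ge0 ?ltW.
  move: h1 h2 h3; lra.
Qed.

End Main.

(** * From p-th powers of distances back to geodesics *)

Theorem theorem10 (R : realType) (p : R) (q : \bar R)
    (hpq : (q = p%:E /\ 2 <= p) \/ (q = 2%:E /\ 1 < p))
    (X Y : diagram R)
    (hX : finite_dist p q X) (hY : finite_dist p q Y)
    (finX : finite_set (offdiag X)) (finY : finite_set (offdiag Y))
    (mu : R -> diagram R) (hmu : geodesic_from_to p q X Y mu) :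
  exists2 gamma : R -> diagram R,
    convex_comb_geodesic p q X Y gamma &
    forall t : R, 0 <= t <= 1 -> dist p q (gamma t) (mu t) = 0%E.
Proof.
have [p1 hg] := qnorm_convex_cost hpq.
set g := (fun v => _) in hg.
have p0 : 0 < p by apply: lt_trans p1.
have pV : p^-1 != 0 by rewrite invr_eq0 gt_eqF.
have distE A B : dist p q A B = poweR (wcost g A B) p^-1 by exact: dist_wcost.
have [[fin_mu cont_mu geo_mu] mu0 mu1] := hmu; subst X Y.
have wfin : (wcost g (mu 0%R) (mu 1%R) < +oo)%E.
  have h A : finite_dist p q A -> (wcost g A (empty_diagram R) < +oo)%E.
    by rewrite /finite_dist/= distE; exact: lty_poweRy.
  by apply: (wcost_lty hg (h _ hX)); rewrite (wcost_sym hg); exact: h.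
have wE : (fine (wcost g (mu 0) (mu 1)))%:E = wcost g (mu 0) (mu 1).
  by rewrite fineK// ge0_fin_numE// (wcost_ge0 hg).
have w0 : 0 <= fine (wcost g (mu 0) (mu 1)) by rewrite fine_ge0// (wcost_ge0 hg).
have w_mu (s t : R) : 0 <= s -> s < t -> t <= 1 ->
    wcost g (mu s) (mu t) = ((t - s) `^ p * fine (wcost g (mu 0) (mu 1)))%:E.
  move=> s0 st t1.
  have powK (x : \bar R) : (0 <= x)%E -> poweR (poweR x p^-1) p = x.
    by move=> x0; rewrite -poweRrM mulVf ?gt_eqF// poweRe1.
  have := geo_mu s t; rewrite s0 t1 (le_trans (ltW st) t1) (le_trans s0 (ltW st)).
  move=> /(_ isT isT); rewrite !distE => /(congr1 (fun x => poweR x p)).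
  rewrite powK ?(wcost_ge0 hg)// => ->.
  rewrite poweRM ?lee_fin ?poweR_ge0// powK ?(wcost_ge0 hg)//.
  by rewrite poweR_EFin ger0_norm ?subr_ge0 ?ltW// EFinM wE.
have [phi [Z [bphi cphi iZ Z0]]] := limit_bijection p1 hg w0 w_mu finX finY.
(* The endpoints must be the given diagrams themselves, whereas interpolation is prescribed only at
   interior times. *)
pose gamma t := if t == 0 then mu 0 else if t == 1 then mu 1 else Z t.
have gamma_mu t : 0 <= t <= 1 -> wcost g (gamma t) (mu t) = 0%E.
  move=> /andP[t0 t1]; rewrite /gamma.
  have [->|n0] := eqVneq t 0; first exact: (wcost_refl p1 hg).
  have [->|n1] := eqVneq t 1; first exact: (wcost_refl p1 hg).
  by apply: Z0; rewrite lt_neqAle eq_sym n0 t0 lt_neqAle n1 t1.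
have g0 : gamma 0 = mu 0 by rewrite /gamma eqxx.
have g1 : gamma 1 = mu 1 by rewrite /gamma oner_eq0 eqxx.
(* Diagrams at distance 0 have the same distances to all others, so [gamma] inherits the geodesic
   property from [mu]. *)
have dist_gamma s A : 0 <= s <= 1 -> dist p q (gamma s) A = dist p q (mu s) A.
  by move=> s01; rewrite !distE (wcost0_eq p1 hg _ (gamma_mu s s01)).
have distC A B : dist p q A B = dist p q B A by rewrite !distE (wcost_sym hg).
have dist_gamma2 s t : 0 <= s <= 1 -> 0 <= t <= 1 ->
    dist p q (gamma s) (gamma t) = dist p q (mu s) (mu t).
  by move=> s01 t01; rewrite dist_gamma// distC dist_gamma// distC.
exists gamma; last by move=> t t01; rewrite distE gamma_mu// poweR0r.
split; last first.
  exists phi; first by split => //; rewrite distE -wE -cphi.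
  move=> t t01; rewrite /gamma; have /andP[t0 t1] := t01.
  by rewrite gt_eqF// lt_eqF//; exact: iZ.
split=> //; split.
- by move=> t t01; rewrite /finite_dist/= dist_gamma//; exact: fin_mu.
- move=> t t01 e e0; have [d d0 hd] := cont_mu t t01 e e0.
  by exists d => // s s01 st; rewrite dist_gamma2//; exact: hd.
- by move=> s t s01 t01; rewrite dist_gamma2// g0 g1; exact: geo_mu.
Qed.
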